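(* Let $v,a,b,c\in\mathbb{C}$ with $\Re(v)<4$, $\Re(c)>0$, and $\Re(vc+a+b)>0$, $\Re(vc+a-b)>0$, $\Re(vc-a+b)>0$, $\Re(vc-a-b)>0$. Put $\sigma_3=\frac v2-\frac{a}{2c}-\frac{b}{2c}$, $\sigma_4=\frac v2-\frac{a}{2c}+\frac{b}{2c}$, $\sigma_5=\frac v2+\frac{a}{2c}+\frac{b}{2c}$, $\sigma_6=\frac v2+\frac{a}{2c}-\frac{b}{2c}$, $P=(vc-a-b)(vc+a+b)(vc-a+b)(vc+a-b)$, and assume $\frac v2\notin\mathbb{Z}_0^-$, $1+\sigma_j\notin\mathbb{Z}_0^-$ ($j=3,4,5,6$). Then $$ \int_0^\infty\frac{\sinh(ax)\sinh(bx)}{\cosh^{v}(cx)}\,dx=\frac{2^{v+1}\,v\,a\,b\,c}{P}\;{}_6F_5\!\left(\begin{matrix}v,\ 1+\frac v2,\ \sigma_3,\ \sigma_5,\ \sigma_4,\ \sigma_6\\ \frac v2,\ 1+\sigma_3,\ 1+\sigma_5,\ 1+\sigma_4,\ 1+\sigma_6\end{matrix};\,-1\right). $$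
   Context: $\mathbb{Z}_0^-=\{0,-1,-2,\dots\}$. The Pochhammer symbol is $(\lambda)_0=1$, $(\lambda)_n=\lambda(\lambda+1)\cdots(\lambda+n-1)$ for $n\ge1$. The generalized hypergeometric series is ${}_pF_q\!\left(\begin{matrix}\alpha_1,\dots,\alpha_p\\ \beta_1,\dots,\beta_q\end{matrix};z\right)=\sum_{n=0}^\infty\frac{(\alpha_1)_n\cdots(\alpha_p)_n}{(\beta_1)_n\cdots(\beta_q)_n}\frac{z^n}{n!}$ (with no $\beta_j\in\mathbb{Z}_0^-$); when $p=q+1$ and $z=-1$ it converges if $\Re(\sum\beta_j-\sum\alpha_i)>-1$. For $\Re(c)>0$ and $x>0$, the complex power $\cosh^{v}(cx)$ means $2^{-v}e^{vcx}(1+e^{-2cx})^{v}$, with the principal branch of $(1+e^{-2cx})^{v}$ (this agrees with the ordinary real power when $c>0$ and $v$ is real). *)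

(* Defs.v *)
From Stdlib Require Import Reals Lra List Arith.
Open Scope R_scope.

Record Cx := mkC { Re : R; Im : R }.

Definition RtoC (x : R) : Cx := mkC x 0.
Definition Cadd (z w : Cx) : Cx := mkC (Re z + Re w) (Im z + Im w).
Definition Copp (z : Cx) : Cx := mkC (- Re z) (- Im z).
Definition Csub (z w : Cx) : Cx := Cadd z (Copp w).
Definition Cmul (z w : Cx) : Cx :=
  mkC (Re z * Re w - Im z * Im w) (Re z * Im w + Im z * Re w).
Definition Cinv (z : Cx) : Cx :=
  mkC (Re z / (Re z ^ 2 + Im z ^ 2)) (- Im z / (Re z ^ 2 + Im z ^ 2)).
Definition Cdiv (z w : Cx) : Cx := Cmul z (Cinv w).

Declare Scope C_scope.
Delimit Scope C_scope with C.
Infix "+" := Cadd : C_scope.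
Infix "-" := Csub : C_scope.
Notation "- z" := (Copp z) : C_scope.
Infix "*" := Cmul : C_scope.
Infix "/" := Cdiv : C_scope.

Definition Cexp (z : Cx) : Cx := mkC (exp (Re z) * cos (Im z)) (exp (Re z) * sin (Im z)).

Definition Cabs (z : Cx) : R := sqrt (Re z ^ 2 + Im z ^ 2).

Definition Carg (z : Cx) : R :=
  if Rlt_dec 0 (Re z) then atan (Im z / Re z)
  else if Rlt_dec (Re z) 0 then
         (if Rle_dec 0 (Im z) then atan (Im z / Re z) + PI
          else atan (Im z / Re z) - PI)
  else if Rlt_dec 0 (Im z) then PI / 2
  else if Rlt_dec (Im z) 0 then - (PI / 2)
  else 0.

Definition Clog (z : Cx) : Cx := mkC (ln (Cabs z)) (Carg z).

(* principal branch z^w := exp (w Log z) (only used for z <> 0) *)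
Definition Cpow (z w : Cx) : Cx := Cexp (Cmul w (Clog z)).

Definition Csinh (z : Cx) : Cx :=
  Cdiv (Csub (Cexp z) (Cexp (Copp z))) (RtoC 2).

(* cosh^v(c x) := 2^{-v} e^{v c x} (1 + e^{-2 c x})^v, principal branch (as in the paper) *)
Definition cosh_pow (v c : Cx) (x : R) : Cx :=
  Cmul (Cpow (RtoC 2) (Copp v))
   (Cmul (Cexp (Cmul v (Cmul c (RtoC x))))
         (Cpow (Cadd (RtoC 1) (Cexp (Cmul (RtoC (-2)) (Cmul c (RtoC x))))) v)).

Fixpoint poch (l : Cx) (n : nat) : Cx :=
  match n with
  | O => RtoC 1
  | S m => Cmul (poch l m) (Cadd l (RtoC (INR m)))
  end.

Fixpoint Cpow_nat (z : Cx) (n : nat) : Cx :=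
  match n with O => RtoC 1 | S m => Cmul (Cpow_nat z m) z end.

Definition Cprod (l : list Cx) : Cx := fold_right Cmul (RtoC 1) l.

Definition hyp_term (al be : list Cx) (z : Cx) (n : nat) : Cx :=
  Cdiv (Cmul (Cprod (map (fun a => poch a n) al)) (Cpow_nat z n))
       (Cmul (Cprod (map (fun b => poch b n) be)) (RtoC (INR (Factorial.fact n)))).

Fixpoint Cpartial (u : nat -> Cx) (N : nat) : Cx :=
  match N with O => u O | S M => Cadd (Cpartial u M) (u N) end.

Definition hyp_series_cv (al be : list Cx) (z : Cx) (S : Cx) : Prop :=
  Un_cv (fun N => Re (Cpartial (hyp_term al be z) N)) (Re S) /\
  Un_cv (fun N => Im (Cpartial (hyp_term al be z) N)) (Im S).

Definition notZ0m (z : Cx) : Prop := forall n : nat, z <> RtoC (- INR n).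

Definition improper_integral_0_inf (f : R -> Cx) (L : Cx) : Prop :=
  (forall B, 0 <= B ->
     inhabited (Riemann_integrable (fun x => Re (f x)) 0 B) /\
     inhabited (Riemann_integrable (fun x => Im (f x)) 0 B)) /\
  (forall eps, 0 < eps -> exists M, forall B (H : M <= B)
     (pr1 : Riemann_integrable (fun x => Re (f x)) 0 B)
     (pr2 : Riemann_integrable (fun x => Im (f x)) 0 B),
     Rabs (RiemannInt pr1 - Re L) < eps /\ Rabs (RiemannInt pr2 - Im L) < eps).

(* Main.v *)
(** Write [z = exp (-2 c x)], [d_n = (-1)^n (v)_n / n!], and let [S_N] be the
    [N]-th partial sum of the binomial series of [(1 + z)^(-v)].  Integrating
    [sinh (a x) sinh (b x) exp (-v c x) S_N] term by term gives the partial sums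
    of the hypergeometric series.  The remainder needs no convergence of the
    binomial series: [G_N = 1 - (1 + z)^v S_N] vanishes at infinity and
    [G_N' = -2 c N d_N z^N (1 + z)^(v-1)], so that
    [|G_N| <= K |d_N| exp (-2 N Re(c) x)].  As [sinh (a x) sinh (b x) exp (-v c x)]
    is [O(x^2)], the error of the integral is [O(|d_N| / N^3)], which tends to [0]
    because [d_N = O(N^q)] with [q < 3] when [Re v < 4].  The same estimate gives
    the convergence of the series at [-1].  Replacing [sinh (a x)] by
    [sinh (a x) / a], read as [x] when [a = 0], keeps this argument valid when
    [a b = 0]. *)

From Stdlib Require Import Reals Lra Lia List.
From Coquelicot Require Import Rcomplements Rbar Hierarchy Continuity Derive AutoDerive RInt RInt_analysis.
Require Import Defs.
Import ListNotations.
Open Scope R_scope.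
Set Bullet Behavior "Strict Subproofs".

(** * Complex arithmetic and derivatives *)

Lemma Cx_eq (z w : Cx) : Re z = Re w -> Im z = Im w -> z = w.
Proof. destruct z, w; simpl; intros; subst; reflexivity. Qed.

Lemma Cx_neq0_norm (z : Cx) : z <> RtoC 0 -> Re z ^ 2 + Im z ^ 2 <> 0.
Proof.
  intros Hz H. apply Hz, Cx_eq; simpl; nra.
Qed.

Lemma Cx_field : field_theory (RtoC 0) (RtoC 1) Cadd Cmul Csub Copp Cdiv Cinv eq.
Proof.
  split; [split| | |]; intros; try reflexivity;
    try (apply Cx_eq; simpl; ring).
  - intros H; injection H; lra.
  - apply Cx_neq0_norm in H. apply Cx_eq; simpl in *; field; lra.
Qed.
Add Field Cx_field_inst : Cx_field.

Lemma RtoC_2 : RtoC 2 = (RtoC 1 + RtoC 1)%C.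
Proof. apply Cx_eq; simpl; ring. Qed.

Lemma RtoC_opp (x : R) : RtoC (- x) = (- RtoC x)%C.
Proof. apply Cx_eq; simpl; ring. Qed.

Lemma RtoC_add (x y : R) : RtoC (x + y) = (RtoC x + RtoC y)%C.
Proof. apply Cx_eq; simpl; ring. Qed.

Lemma RtoC_mul (x y : R) : RtoC (x * y) = (RtoC x * RtoC y)%C.
Proof. apply Cx_eq; simpl; ring. Qed.

Lemma RtoC_neq0 (x : R) : x <> 0 -> RtoC x <> RtoC 0.
Proof. intros H E; injection E; auto. Qed.

Lemma Re_neq0 (z : Cx) : Re z <> 0 -> z <> RtoC 0.
Proof. intros H E; rewrite E in H; apply H; reflexivity. Qed.

Lemma Cx_eq_dec (z w : Cx) : {z = w} + {z <> w}.
Proof.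
  destruct (Req_dec_T (Re z) (Re w)) as [H|H].
  - destruct (Req_dec_T (Im z) (Im w)) as [H'|H'].
    + left; apply Cx_eq; auto.
    + right; intros E; apply H'; rewrite E; auto.
  - right; intros E; apply H; rewrite E; auto.
Qed.

Lemma Cmul_neq0 (z w : Cx) : z <> RtoC 0 -> w <> RtoC 0 -> (z * w)%C <> RtoC 0.
Proof.
  intros Hz Hw E. apply Hw.
  replace w with (Cinv z * (z * w))%C by (field; auto). rewrite E; ring.
Qed.

Lemma Cabs_sqr (z : Cx) : Cabs z ^ 2 = Re z ^ 2 + Im z ^ 2.
Proof. unfold Cabs. rewrite pow2_sqrt; nra. Qed.

Lemma Cabs_pos (z : Cx) : 0 <= Cabs z.
Proof. apply sqrt_pos. Qed.

Lemma Cabs_mul (z w : Cx) : Cabs (z * w)%C = Cabs z * Cabs w.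
Proof.
  unfold Cabs. rewrite <- sqrt_mult by nra. f_equal. simpl; ring.
Qed.

Lemma Cabs_RtoC (x : R) : Cabs (RtoC x) = Rabs x.
Proof.
  unfold Cabs; simpl. rewrite <- sqrt_Rsqr_abs. f_equal. unfold Rsqr; ring.
Qed.

Lemma Cabs_le_of_sqr (z : Cx) (M : R) : 0 <= M -> Re z ^ 2 + Im z ^ 2 <= M ^ 2 -> Cabs z <= M.
Proof.
  intros HM H. apply Rsqr_incr_0_var; auto.
  unfold Rsqr. pose proof (Cabs_sqr z). nra.
Qed.

Lemma Re_le_Cabs (z : Cx) : Rabs (Re z) <= Cabs z.
Proof.
  pose proof (Cabs_sqr z); pose proof (Cabs_pos z).
  apply Rabs_le; split; nra.
Qed.

Lemma Im_le_Cabs (z : Cx) : Rabs (Im z) <= Cabs z.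
Proof.
  pose proof (Cabs_sqr z); pose proof (Cabs_pos z).
  apply Rabs_le; split; nra.
Qed.

Lemma Cabs_le_sum (z : Cx) : Cabs z <= Rabs (Re z) + Rabs (Im z).
Proof.
  pose proof (Rabs_pos (Re z)); pose proof (Rabs_pos (Im z)).
  apply Cabs_le_of_sqr; [lra|].
  rewrite <- (pow2_abs (Re z)), <- (pow2_abs (Im z)). nra.
Qed.

Lemma Cabs_opp (z : Cx) : Cabs (- z)%C = Cabs z.
Proof. unfold Cabs; simpl; f_equal; ring. Qed.

Lemma Cabs_add (z w : Cx) : Cabs (z + w)%C <= Cabs z + Cabs w.
Proof.
  pose proof (Cabs_sqr z); pose proof (Cabs_sqr w).
  pose proof (Cabs_pos z); pose proof (Cabs_pos w).
  assert (0 <= Cabs z * Cabs w) by (apply Rmult_le_pos; auto).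
  assert (H4 : (Re z * Re w + Im z * Im w) ^ 2 <= (Cabs z * Cabs w) ^ 2).
  { rewrite Rpow_mult_distr, H, H0. pose proof (pow2_ge_0 (Re z * Im w - Im z * Re w)). nra. }
  assert (Re z * Re w + Im z * Im w <= Cabs z * Cabs w) by nra.
  apply Cabs_le_of_sqr; [lra|]. simpl Re; simpl Im. nra.
Qed.

Lemma Cabs_exp (z : Cx) : Cabs (Cexp z) = exp (Re z).
Proof.
  unfold Cabs; simpl.
  replace (_ + _) with (exp (Re z) * exp (Re z) * (Rsqr (sin (Im z)) + Rsqr (cos (Im z))))
    by (unfold Rsqr; ring).
  rewrite sin2_cos2, Rmult_1_r. apply sqrt_square, Rlt_le, exp_pos.
Qed.

Lemma Cabs_inv (z : Cx) : z <> RtoC 0 -> Cabs (Cinv z) = / Cabs z.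
Proof.
  intros Hz.
  assert (E : Cabs (z * Cinv z)%C = 1).
  { replace (z * Cinv z)%C with (RtoC 1) by (field; auto). rewrite Cabs_RtoC, Rabs_R1; auto. }
  rewrite Cabs_mul in E.
  assert (Cabs z <> 0) by (intros H; rewrite H in E; lra).
  apply Rmult_eq_reg_l with (Cabs z); auto. rewrite E; field; auto.
Qed.

Lemma Cexp_add (z w : Cx) : Cexp (z + w)%C = (Cexp z * Cexp w)%C.
Proof.
  apply Cx_eq; simpl; rewrite exp_plus, ?cos_plus, ?sin_plus; ring.
Qed.

Lemma Cexp_0 : Cexp (RtoC 0) = RtoC 1.
Proof. apply Cx_eq; simpl; rewrite exp_0, ?cos_0, ?sin_0; ring. Qed.

Lemma Cexp_opp (z : Cx) : (Cexp (- z) * Cexp z)%C = RtoC 1.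
Proof. rewrite <- Cexp_add, <- Cexp_0. f_equal; ring. Qed.

Lemma Cexp_neq0 (z : Cx) : Cexp z <> RtoC 0.
Proof.
  intros H. pose proof (Cexp_opp z) as E. rewrite H in E.
  injection E; intros; lra.
Qed.

Lemma Cexp_inv (z : Cx) : Cinv (Cexp z) = Cexp (- z)%C.
Proof.
  pose proof (Cexp_opp z). pose proof (Cexp_neq0 z).
  replace (Cexp (- z))%C with ((Cexp (- z) * Cexp z) * Cinv (Cexp z))%C by (field; auto).
  rewrite H; ring.
Qed.

Definition is_derive_C (f : R -> Cx) (x : R) (l : Cx) : Prop :=
  is_derive (fun t => Re (f t)) x (Re l) /\ is_derive (fun t => Im (f t)) x (Im l).

Lemma is_derive_C_eq (f : R -> Cx) (x : R) (l l' : Cx) :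
  is_derive_C f x l -> l = l' -> is_derive_C f x l'.
Proof. intros; subst; auto. Qed.

Lemma is_derive_C_ext (f g : R -> Cx) (x : R) (l : Cx) :
  (forall t, f t = g t) -> is_derive_C f x l -> is_derive_C g x l.
Proof.
  intros H [H1 H2]; split; eapply is_derive_ext; try eassumption;
    intros t; simpl; rewrite H; auto.
Qed.

Lemma is_derive_C_const (k : Cx) (x : R) : is_derive_C (fun _ => k) x (RtoC 0).
Proof. split; simpl; auto_derive; auto. Qed.

Lemma is_derive_C_RtoC (x : R) : is_derive_C RtoC x (RtoC 1).
Proof. split; simpl; auto_derive; auto. Qed.

Lemma is_derive_C_add (f g : R -> Cx) (x : R) (l m : Cx) :
  is_derive_C f x l -> is_derive_C g x m ->
  is_derive_C (fun t => f t + g t)%C x (l + m)%C.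
Proof.
  intros [H1 H2] [H3 H4]; split; simpl; apply (is_derive_plus (V := R_NormedModule)); auto.
Qed.

Lemma is_derive_ln_sqrt (f g : R -> R) (x df dg : R) :
  0 < f x -> is_derive f x df -> is_derive g x dg ->
  is_derive (fun t => ln (sqrt (f t ^ 2 + g t ^ 2))) x
    ((f x * df + g x * dg) / (f x ^ 2 + g x ^ 2)).
Proof.
  intros Hpos H1 H2.
  pose proof (ex_intro _ _ H1 : ex_derive _ _). pose proof (ex_intro _ _ H2 : ex_derive _ _).
  assert (Hn : 0 < f x * (f x * 1) + g x * (g x * 1)) by nra.
  pose proof (sqrt_lt_R0 _ Hn) as Hs.
  auto_derive; [tauto|].
  replace (Derive (fun x0 => f x0) x) with df by (symmetry; apply is_derive_unique; auto).
  replace (Derive (fun x0 => g x0) x) with dg by (symmetry; apply is_derive_unique; auto).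
  pose proof (sqrt_sqrt _ (Rlt_le _ _ Hn)) as E.
  set (s := sqrt _) in *.
  replace (f x ^ 2 + g x ^ 2) with (s * s) by (rewrite E; ring).
  field. lra.
Qed.

Lemma is_derive_atan_div (f g : R -> R) (x df dg : R) :
  0 < f x -> is_derive f x df -> is_derive g x dg ->
  is_derive (fun t => atan (g t / f t)) x
    ((f x * dg - g x * df) / (f x ^ 2 + g x ^ 2)).
Proof.
  intros Hpos H1 H2.
  pose proof (ex_intro _ _ H1 : ex_derive _ _). pose proof (ex_intro _ _ H2 : ex_derive _ _).
  assert (Hn : 0 < f x * (f x * 1) + g x * (g x * 1)) by nra.
  assert (f x <> 0) by lra.
  auto_derive; [tauto|].
  replace (Derive (fun x0 => f x0) x) with df by (symmetry; apply is_derive_unique; auto).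
  replace (Derive (fun x0 => g x0) x) with dg by (symmetry; apply is_derive_unique; auto).
  field. split; nra.
Qed.

Lemma is_derive_C_mul (f g : R -> Cx) (x : R) (l m : Cx) :
  is_derive_C f x l -> is_derive_C g x m ->
  is_derive_C (fun t => f t * g t)%C x (l * g x + f x * m)%C.
Proof.
  intros [H1 H2] [H3 H4]. split.
  - replace (Re _) with (minus (Re l * Re (g x) + Re (f x) * Re m)
      (Im l * Im (g x) + Im (f x) * Im m)) by (unfold minus, plus, opp; simpl; ring).
    apply (is_derive_minus (V := R_NormedModule)
      (fun t => Re (f t) * Re (g t)) (fun t => Im (f t) * Im (g t)));
      apply is_derive_mult; auto.
  - replace (Im _) with (plus (Re l * Im (g x) + Re (f x) * Im m)
      (Im l * Re (g x) + Im (f x) * Re m)) by (unfold plus; simpl; ring).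
    apply (is_derive_plus (V := R_NormedModule)
      (fun t => Re (f t) * Im (g t)) (fun t => Im (f t) * Re (g t)));
      apply is_derive_mult; auto.
Qed.

Lemma is_derive_C_scal (k : Cx) (f : R -> Cx) (x : R) (l : Cx) :
  is_derive_C f x l -> is_derive_C (fun t => k * f t)%C x (k * l)%C.
Proof.
  intros H. eapply is_derive_C_eq.
  - apply is_derive_C_mul; [apply is_derive_C_const | exact H].
  - simpl; ring.
Qed.

Lemma is_derive_C_exp (f : R -> Cx) (x : R) (l : Cx) :
  is_derive_C f x l -> is_derive_C (fun t => Cexp (f t)) x (l * Cexp (f x))%C.
Proof.
  intros [H1 H2].
  pose proof (is_derive_comp exp _ x _ _ (ElemFct.is_derive_exp _) H1) as He.
  pose proof (is_derive_comp cos _ x _ _ (ElemFct.is_derive_cos _) H2) as Hc.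
  pose proof (is_derive_comp sin _ x _ _ (ElemFct.is_derive_sin _) H2) as Hs.
  pose proof (is_derive_mult _ _ _ _ _ He Hc) as H3.
  pose proof (is_derive_mult _ _ _ _ _ He Hs) as H4.
  unfold scal in *; simpl in *; unfold mult in *; simpl in *.
  split; simpl.
  - evar_last; [exact H3 | ring].
  - evar_last; [exact H4 | ring].
Qed.

Lemma is_derive_C_log (f : R -> Cx) (x : R) (l : Cx) :
  0 < Re (f x) -> is_derive_C f x l -> is_derive_C (fun t => Clog (f t)) x (l / f x)%C.
Proof.
  intros Hpos [H1 H2].
  assert (Hn : 0 < Re (f x) ^ 2 + Im (f x) ^ 2) by nra.
  split.
  - evar_last; [exact (is_derive_ln_sqrt _ _ _ _ _ Hpos H1 H2)|].
    simpl in *; field; lra.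
  - apply is_derive_ext_loc with (fun t => atan (Im (f t) / Re (f t))).
    + assert (Hc : continuous (fun t => Re (f t)) x)
        by (apply (ex_derive_continuous (fun t => Re (f t))); eexists; eassumption).
      assert (Hl : locally x (fun t => 0 < Re (f t))).
      { apply (Hc (fun y => 0 < y)). apply (open_gt 0); auto. }
      revert Hl; apply filter_imp. intros t Ht. simpl. unfold Carg.
      destruct (Rlt_dec 0 (Re (f t))); [reflexivity | contradiction].
    + evar_last; [exact (is_derive_atan_div (fun t => Re (f t)) (fun t => Im (f t)) _ _ _ Hpos H1 H2)|].
      simpl in *; field; lra.
Qed.

Lemma is_derive_C_continuous (f : R -> Cx) (x : R) (l : Cx) :
  is_derive_C f x l ->
  continuous (fun t => Re (f t)) x /\ continuous (fun t => Im (f t)) x.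
Proof.
  intros [H1 H2]; split;
    [apply (ex_derive_continuous (fun t => Re (f t))) | apply (ex_derive_continuous (fun t => Im (f t)))];
    eexists; eassumption.
Qed.

(** * Limits and real estimates *)

Lemma exp_le_exp (x y : R) : x <= y -> exp x <= exp y.
Proof. intros [H|H]; [left; apply exp_increasing; auto | subst; right; auto]. Qed.

Definition is_lim_C (f : R -> Cx) (l : Cx) : Prop :=
  is_lim (fun t => Re (f t)) p_infty (Re l) /\ is_lim (fun t => Im (f t)) p_infty (Im l).

Lemma is_lim_C_const (k : Cx) : is_lim_C (fun _ => k) k.
Proof. split; apply is_lim_const. Qed.

Lemma is_lim_plus_fin (f g : R -> R) (l m : R) :
  is_lim f p_infty l -> is_lim g p_infty m -> is_lim (fun t => f t + g t) p_infty (l + m).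
Proof. intros Hf Hg. eapply is_lim_plus; [exact Hf | exact Hg | reflexivity]. Qed.

Lemma is_lim_mult_fin (f g : R -> R) (l m : R) :
  is_lim f p_infty l -> is_lim g p_infty m -> is_lim (fun t => f t * g t) p_infty (l * m).
Proof. intros Hf Hg. apply (is_lim_mult f g p_infty l m); auto. exact I. Qed.

Lemma is_lim_minus_fin (f g : R -> R) (l m : R) :
  is_lim f p_infty l -> is_lim g p_infty m -> is_lim (fun t => f t - g t) p_infty (l - m).
Proof. intros Hf Hg. eapply is_lim_minus; [exact Hf | exact Hg | reflexivity]. Qed.

Lemma is_lim_C_add (f g : R -> Cx) (l m : Cx) :
  is_lim_C f l -> is_lim_C g m -> is_lim_C (fun t => f t + g t)%C (l + m)%C.
Proof.
  intros [H1 H2] [H3 H4]; split; simpl; apply is_lim_plus_fin; auto.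
Qed.

Lemma is_lim_C_mul (f g : R -> Cx) (l m : Cx) :
  is_lim_C f l -> is_lim_C g m -> is_lim_C (fun t => f t * g t)%C (l * m)%C.
Proof.
  intros [H1 H2] [H3 H4]; split; simpl.
  - apply is_lim_minus_fin; apply is_lim_mult_fin; auto.
  - apply is_lim_plus_fin; apply is_lim_mult_fin; auto.
Qed.

Lemma is_lim_C_exp (f : R -> Cx) (l : Cx) :
  is_lim_C f l -> is_lim_C (fun t => Cexp (f t)) (Cexp l).
Proof.
  intros [H1 H2].
  assert (He : is_lim (fun t => exp (Re (f t))) p_infty (exp (Re l))).
  { apply (is_lim_comp_continuous _ exp); auto. apply (ex_derive_continuous exp); auto_derive; auto. }
  split; simpl; apply is_lim_mult_fin; auto.
  - apply (is_lim_comp_continuous _ cos); auto. apply (ex_derive_continuous cos); auto_derive; auto.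
  - apply (is_lim_comp_continuous _ sin); auto. apply (ex_derive_continuous sin); auto_derive; auto.
Qed.

Lemma is_lim_p_infty_eps (f : R -> R) (l : R) :
  is_lim f p_infty l <->
  (forall eps, 0 < eps -> exists M, forall x, M < x -> Rabs (f x - l) < eps).
Proof.
  rewrite <- is_lim_spec. split; intros H eps.
  - intros He. destruct (H (mkposreal eps He)) as [M HM]. exists M; auto.
  - destruct (H eps (cond_pos eps)) as [M HM]. exists M; auto.
Qed.

Lemma is_lim_C_log (f : R -> Cx) : is_lim_C f (RtoC 1) -> is_lim_C (fun t => Clog (f t)) (RtoC 0).
Proof.
  intros [H1 H2]; simpl in *.
  pose proof (is_lim_plus_fin _ _ _ _ (is_lim_mult_fin _ _ _ _ H1 H1) (is_lim_mult_fin _ _ _ _ H2 H2)) as H3.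
  split; simpl.
  - assert (C : is_lim (fun t => ln (sqrt (Re (f t) * Re (f t) + Im (f t) * Im (f t)))) p_infty
              (ln (sqrt (1 * 1 + 0 * 0)))).
    { apply (is_lim_comp_continuous _ (fun y => ln (sqrt y))); auto.
      replace (1 * 1 + 0 * 0) with 1 by ring.
      apply (ex_derive_continuous (fun y => ln (sqrt y))).
      auto_derive. repeat split; try lra. rewrite sqrt_1; lra. }
    replace (1 * 1 + 0 * 0) with 1 in C by ring. rewrite sqrt_1, ln_1 in C.
    eapply is_lim_ext; [|exact C]. intros t; simpl; unfold Cabs; do 2 f_equal; ring.
  - assert (C : is_lim (fun t => atan (Im (f t) * / Re (f t))) p_infty (atan (0 * / 1))).
    { apply (is_lim_comp_continuous _ atan).
      - apply is_lim_mult_fin; auto. apply (is_lim_comp_continuous _ Rinv); auto.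
        apply (ex_derive_continuous Rinv). auto_derive; lra.
      - apply (ex_derive_continuous atan). auto_derive; auto. }
    rewrite Rmult_0_l, atan_0 in C.
    eapply is_lim_ext_loc; [|exact C]. simpl.
    destruct (proj1 (is_lim_p_infty_eps _ _) H1 1 ltac:(lra)) as [M HM].
    exists M; intros x Hx. specialize (HM x Hx). apply Rabs_def2 in HM.
    unfold Carg. destruct (Rlt_dec 0 (Re (f x))); [reflexivity | lra].
Qed.

Lemma is_lim_exp_decay (k : R) : 0 < k -> is_lim (fun x => exp (- k * x)) p_infty 0.
Proof.
  intros Hk.
  apply is_lim_p_infty_eps. intros eps He.
  exists (- ln eps / k). intros x Hx.
  rewrite Rminus_0_r, Rabs_pos_eq by (left; apply exp_pos).
  rewrite <- (exp_ln eps) at 1 by auto. apply exp_increasing.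
  apply Rmult_lt_compat_l with (r := k) in Hx; auto.
  replace (k * (- ln eps / k)) with (- ln eps) in Hx by (field; lra). lra.
Qed.

Lemma is_lim_C_zero_of_decay (f : R -> Cx) (C k : R) :
  0 < k -> (forall x, 0 <= x -> Cabs (f x) <= C * exp (- k * x)) -> is_lim_C f (RtoC 0).
Proof.
  intros Hk H.
  assert (Hb : is_lim (fun x => C * exp (- k * x)) p_infty 0).
  { replace 0 with (C * 0) by ring. apply is_lim_mult_fin;
      [apply is_lim_const | apply is_lim_exp_decay; auto]. }
  rewrite is_lim_p_infty_eps in Hb.
  split; apply is_lim_p_infty_eps; intros eps He; destruct (Hb eps He) as [M HM];
    exists (Rmax M 0); intros x Hx;
    assert (M < x /\ 0 < x) as [Hx1 Hx2] by (split; eapply Rle_lt_trans;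
      [apply Rmax_l | eassumption | apply Rmax_r | eassumption]);
    specialize (HM x Hx1); specialize (H x (Rlt_le _ _ Hx2));
    simpl; rewrite Rminus_0_r in *; apply Rabs_def2 in HM;
    [pose proof (Re_le_Cabs (f x)) | pose proof (Im_le_Cabs (f x))]; lra.
Qed.

Lemma sqr_le_exp (k : R) : 0 < k -> exists C, 0 <= C /\ forall x, 0 <= x -> (1 + x) ^ 2 <= C * exp (k * x).
Proof.
  intros Hk. exists ((1 + 2 / k) ^ 2). split; [apply pow2_ge_0|]. intros x Hx.
  assert (E : exp (k * x) = exp (k * x / 2) ^ 2).
  { simpl. rewrite Rmult_1_r, <- exp_plus. f_equal; field. }
  rewrite E, <- Rpow_mult_distr.
  pose proof (exp_ineq1_le (k * x / 2)).
  assert (Hk' : 0 < 2 / k) by (apply Rdiv_lt_0_compat; lra).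
  apply pow_incr. split; [lra|].
  apply Rle_trans with ((1 + 2 / k) * (1 + k * x / 2)).
  - replace ((1 + 2 / k) * (1 + k * x / 2)) with (1 + x + 2 / k + k * x / 2) by (field; lra). nra.
  - apply Rmult_le_compat_l; lra.
Qed.

Lemma increment_bound (g h g' h' : R -> R) (a b : R) :
  a <= b ->
  (forall x, a <= x <= b -> is_derive g x (g' x)) ->
  (forall x, a <= x <= b -> is_derive h x (h' x)) ->
  (forall x, a <= x <= b -> Rabs (g' x) <= h' x) ->
  Rabs (g b - g a) <= h b - h a.
Proof.
  intros Hab Hg Hh H.
  destruct (Req_dec a b) as [E|E]; [subst; rewrite Rminus_diag, Rabs_R0; lra|].
  assert (Hab' : a < b) by lra.
  destruct (MVT_cor2 (fun x => h x - g x) (fun x => h' x - g' x) a b Hab') as [c1 [E1 Hc1]].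
  { intros c Hc. apply is_derive_Reals.
    apply (is_derive_minus (V := R_NormedModule)); auto. }
  destruct (MVT_cor2 (fun x => h x + g x) (fun x => h' x + g' x) a b Hab') as [c2 [E2 Hc2]].
  { intros c Hc. apply is_derive_Reals.
    apply (is_derive_plus (V := R_NormedModule)); auto. }
  pose proof (H c1 ltac:(lra)) as B1. pose proof (H c2 ltac:(lra)) as B2.
  apply Rabs_le_between in B1. apply Rabs_le_between in B2.
  apply Rabs_le. split; nra.
Qed.

Lemma decay_of_derivative_decay (g g' : R -> R) (A m : R) :
  0 <= A -> 0 < m ->
  (forall x, 0 <= x -> is_derive g x (g' x)) ->
  (forall x, 0 <= x -> Rabs (g' x) <= A * m * exp (- m * x)) ->
  is_lim g p_infty 0 ->
  forall x, 0 <= x -> Rabs (g x) <= A * exp (- m * x).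
Proof.
  intros HA Hm Hg Hb Hl x Hx.
  apply le_epsilon. intros eps He.
  destruct (proj1 (is_lim_p_infty_eps _ _) Hl eps He) as [M HM].
  set (y := Rmax M x + 1).
  assert (M < y /\ x <= y) as [HMy Hxy]
    by (unfold y; pose proof (Rmax_l M x); pose proof (Rmax_r M x); lra).
  specialize (HM y HMy). rewrite Rminus_0_r in HM.
  assert (H : Rabs (g y - g x) <= - A * exp (- m * y) - - A * exp (- m * x)).
  { apply (increment_bound g (fun t => - A * exp (- m * t)) g' (fun t => A * m * exp (- m * t))); auto.
    - intros t Ht; apply Hg; lra.
    - intros t Ht. auto_derive; auto. ring.
    - intros t Ht; apply Hb; lra. }
  pose proof (exp_pos (- m * y)).
  assert (0 <= A * exp (- m * y)) by nra.
  apply Rabs_def2 in HM. apply Rabs_le_between in H. apply Rabs_le. lra.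
Qed.

Lemma RInt_sqr_exp_bound (h : R -> R) (C m B l : R) :
  0 <= C -> 0 < m -> 0 <= B ->
  (forall x, 0 <= x <= B -> Rabs (h x) <= C * (x ^ 2 * exp (- m * x))) ->
  is_RInt h 0 B l -> Rabs l <= 2 * C / m ^ 3.
Proof.
  intros HC Hm HB Hh Hl.
  set (F := fun x => - (C * ((x ^ 2 / m + 2 * x / m ^ 2 + 2 / m ^ 3) * exp (- m * x)))).
  assert (HI : is_RInt (fun x => C * (x ^ 2 * exp (- m * x))) 0 B (minus (F B) (F 0))).
  { apply (is_RInt_derive F).
    - intros x _. unfold F. auto_derive; auto. field. lra.
    - intros x _. apply (ex_derive_continuous (fun x => C * (x ^ 2 * exp (- m * x)))).
      auto_derive; auto. }
  eapply Rle_trans.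
  - exact (norm_RInt_le (V := R_NormedModule) h _ 0 B l _ HB Hh Hl HI).
  - unfold minus, plus, opp; simpl; unfold F.
    replace (- m * 0) with 0 by ring. rewrite exp_0.
    assert (0 <= C * ((B ^ 2 / m + 2 * B / m ^ 2 + 2 / m ^ 3) * exp (- m * B))).
    { apply Rmult_le_pos; auto. apply Rmult_le_pos; [|left; apply exp_pos].
      assert (0 < m ^ 2) by (apply pow_lt; auto).
      assert (0 < m ^ 3) by (apply pow_lt; auto).
      pose proof (pow_le B 2 HB).
      repeat apply Rplus_le_le_0_compat; apply Rdiv_le_0_compat; lra. }
    match goal with H : 0 <= ?X |- _ => apply Rle_trans with (2 * C / m ^ 3 - X) end.
    + right; field; lra.
    + apply Rle_minus_l, Rle_trans with (2 * C / m ^ 3 + 0); [rewrite Rplus_0_r; apply Rle_refl|].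
      apply Rplus_le_compat_l; assumption.
Qed.

Lemma improper_integral_by_approximation (j : R -> R) (A A' : nat -> R -> R) (C m : nat -> R) :
  (forall x, 0 <= x -> continuous j x) ->
  (forall N x, 0 <= x -> is_derive (A N) x (A' N x)) ->
  (forall N x, 0 <= x -> continuous (A' N) x) ->
  (forall N, is_lim (A N) p_infty 0) ->
  (forall N, (1 <= N)%nat -> 0 <= C N /\ 0 < m N /\
     forall x, 0 <= x -> Rabs (j x - A' N x) <= C N * (x ^ 2 * exp (- m N * x))) ->
  Un_cv (fun N => 2 * C N / m N ^ 3) 0 ->
  exists L, Un_cv (fun N => - A N 0) L /\
    forall eps, 0 < eps -> exists M, forall B, M <= B -> 0 <= B -> Rabs (RInt j 0 B - L) < eps.
Proof.
  intros Hj HA HA' Hlim Hrem He.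
  set (e := fun N => 2 * C N / m N ^ 3) in *.
  assert (Hex : forall B, 0 <= B -> ex_RInt j 0 B).
  { intros B HB. apply (ex_RInt_continuous (V := R_CompleteNormedModule)).
    intros x Hx. rewrite Rmin_left, Rmax_right in Hx by lra. apply Hj; lra. }
  assert (K : forall N eps, (1 <= N)%nat -> 0 < eps -> exists M, forall B, M <= B -> 0 <= B ->
             Rabs (RInt j 0 B - - A N 0) < e N + eps).
  { intros N eps HN Heps.
    destruct (Hrem N HN) as [HC [Hm Hb]].
    destruct (proj1 (is_lim_p_infty_eps _ _) (Hlim N) eps Heps) as [M HM].
    exists (M + 1). intros B HB HB0.
    assert (HI : is_RInt (A' N) 0 B (minus (A N B) (A N 0))).
    { apply (is_RInt_derive (A N)); intros x Hx; rewrite Rmin_left, Rmax_right in Hx by lra;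
        [apply HA | apply HA']; lra. }
    pose proof (is_RInt_minus _ _ _ _ _ _ (RInt_correct j 0 B (Hex B HB0)) HI) as HD.
    apply (RInt_sqr_exp_bound _ (C N) (m N)) in HD; auto.
    - specialize (HM B ltac:(lra)).
      change (Rabs (RInt j 0 B - (A N B - A N 0)) <= e N) in HD.
      apply Rabs_def2 in HM. apply Rabs_le_between in HD. apply Rabs_def1; lra.
    - intros x Hx. apply Hb; lra. }
  assert (He' : forall eps, 0 < eps -> exists N0, forall N, (N0 <= N)%nat -> e N < eps).
  { intros eps Heps. destruct (He eps Heps) as [N0 HN0]. exists N0. intros N HN.
    specialize (HN0 N HN). unfold Rdist in HN0. apply Rabs_def2 in HN0. lra. }
  destruct (Rcomplete.R_complete (fun N => - A N 0)) as [L HL].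
  { intros eps Heps. destruct (He' (eps / 4) ltac:(lra)) as [N0 HN0].
    exists (S N0). intros n p Hn Hp.
    destruct (K n (eps / 4)) as [M1 HM1]; [lia|lra|].
    destruct (K p (eps / 4)) as [M2 HM2]; [lia|lra|].
    set (B := Rmax 0 (Rmax M1 M2)).
    assert (0 <= B /\ M1 <= B /\ M2 <= B) as [HB0 [HB1 HB2]].
    { unfold B. pose proof (Rmax_l 0 (Rmax M1 M2)); pose proof (Rmax_r 0 (Rmax M1 M2)).
      pose proof (Rmax_l M1 M2); pose proof (Rmax_r M1 M2). lra. }
    specialize (HM1 B HB1 HB0). specialize (HM2 B HB2 HB0).
    pose proof (HN0 n ltac:(lia)). pose proof (HN0 p ltac:(lia)).
    apply Rabs_def2 in HM1. apply Rabs_def2 in HM2.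
    unfold Rdist. apply Rabs_def1; lra. }
  exists L. split; [exact HL|].
  intros eps Heps. destruct (He' (eps / 4) ltac:(lra)) as [N0 HN0].
  destruct (HL (eps / 4) ltac:(lra)) as [N1 HN1].
  set (N := S (N0 + N1)).
  destruct (K N (eps / 4)) as [M HM]; [unfold N; lia|lra|].
  exists M. intros B HB HB0. specialize (HM B HB HB0).
  specialize (HN0 N ltac:(unfold N; lia)). specialize (HN1 N ltac:(unfold N; lia)).
  unfold Rdist in HN1. apply Rabs_def2 in HM. apply Rabs_def2 in HN1. apply Rabs_def1; lra.
Qed.

(* The exponent of the bound absorbs [1/(n+1) - ln((n+2)/(n+1)) <= 1/(n+1)^2]
   into the telescoping quantity [1 - 1/(n+1)]. *)
Lemma binomial_coef_growth (d : nat -> Cx) (v : Cx) (q : R) :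
  0 <= q -> Re v - 1 <= q ->
  Cabs (d O) = 1 ->
  (forall n, Cabs (d (S n)) * (INR n + 1) = Cabs (d n) * Cabs (v + RtoC (INR n))%C) ->
  exists K, 0 <= K /\ forall n, Cabs (d n) <= K * exp (q * ln (INR n + 1)).
Proof.
  intros Hq Hv H0 HS.
  set (k := (Re v - 1) ^ 2 + Im v ^ 2 + 2 * q).
  assert (Hk : 0 <= k) by (unfold k; nra).
  assert (B : forall n, Cabs (d n) ^ 2 <= exp (2 * q * ln (INR n + 1) + 2 * k * (1 - / (INR n + 1)))).
  { induction n as [|n IH].
    - rewrite H0. simpl INR. rewrite Rplus_0_l, ln_1, Rinv_1.
      replace (2 * q * 0 + _) with 0 by ring. rewrite exp_0; lra.
    - rewrite S_INR. set (t := INR n + 1) in *.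
      assert (Ht : 1 <= t) by (unfold t; pose proof (pos_INR n); lra).
      assert (E : Cabs (d (S n)) ^ 2 =
                  Cabs (d n) ^ 2 * (1 + (2 * (Re v - 1) / t + ((Re v - 1) ^ 2 + Im v ^ 2) / t ^ 2))).
      { assert (E1 : Cabs (d (S n)) = Cabs (d n) * Cabs (v + RtoC (INR n))%C / t)
          by (rewrite <- HS; unfold t in *; field; lra).
        rewrite E1. unfold Rdiv. rewrite !Rpow_mult_distr, (Cabs_sqr (v + _)%C). simpl Re. simpl Im.
        replace (INR n) with (t - 1) by (unfold t; ring). field. lra. }
      rewrite E.
      apply Rle_trans with (exp (2 * q * ln t + 2 * k * (1 - / t)) *
        exp (2 * (Re v - 1) / t + ((Re v - 1) ^ 2 + Im v ^ 2) / t ^ 2)).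
      + apply Rmult_le_compat; auto using pow2_ge_0.
        * assert (E2 : Cabs (v + RtoC (INR n))%C ^ 2 / t ^ 2 =
             1 + (2 * (Re v - 1) / t + ((Re v - 1) ^ 2 + Im v ^ 2) / t ^ 2)).
          { rewrite Cabs_sqr. simpl Re. simpl Im.
            replace (INR n) with (t - 1) by (unfold t; ring). field. lra. }
          rewrite <- E2. apply Rmult_le_pos; [apply pow2_ge_0|].
          left; apply Rinv_0_lt_compat; nra.
        * apply exp_ineq1_le.
      + rewrite <- exp_plus. 
        assert (Hi : 0 < / t) by (apply Rinv_0_lt_compat; lra).
        assert (Hi1 : 0 < / (t + 1)) by (apply Rinv_0_lt_compat; lra).
        assert (Hln : / (t + 1) <= ln (t + 1) - ln t).
        { pose proof (exp_ineq1_le (ln t - ln (t + 1))) as Hx.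
          unfold Rminus in Hx. rewrite exp_plus, exp_Ropp, !exp_ln in Hx by lra.
          replace (t * / (t + 1)) with (1 - / (t + 1)) in Hx by (field; lra). lra. }
        assert (H1 : / t <= / (t + 1) + / t ^ 2).
        { replace (/ t) with (/ (t + 1) + / (t * (t + 1))) at 1 by (field; lra).
          apply Rplus_le_compat_l. apply Rinv_le_contravar; nra. }
        assert (H2 : / t ^ 2 <= 2 * (/ t - / (t + 1))).
        { replace (2 * (/ t - / (t + 1))) with (/ t ^ 2 * (2 * t / (t + 1))) by (field; lra).
          rewrite <- (Rmult_1_r (/ t ^ 2)) at 1. apply Rmult_le_compat_l.
          - left; apply Rinv_0_lt_compat; nra.
          - apply Rmult_le_reg_r with (t + 1); [lra|]. unfold Rdiv.
            rewrite Rmult_assoc, Rinv_l; lra. }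
        assert (H3 : 0 < / t ^ 2) by (apply Rinv_0_lt_compat; nra).
        unfold Rdiv.
        assert (G1 : 2 * (Re v - 1) * / t <= 2 * q * / t) by (apply Rmult_le_compat_r; lra).
        assert (G2 : 2 * q * / t <= 2 * q * (ln (t + 1) - ln t + / t ^ 2))
          by (apply Rmult_le_compat_l; lra).
        assert (G3 : k * / t ^ 2 <= k * (2 * (/ t - / (t + 1)))) by (apply Rmult_le_compat_l; lra).
        assert (G4 : ((Re v - 1) ^ 2 + Im v ^ 2) * / t ^ 2 = k * / t ^ 2 - 2 * q * / t ^ 2)
          by (unfold k; ring).
        apply exp_le_exp. lra. }
  exists (exp k). split; [left; apply exp_pos|].
  intros n. apply Rsqr_incr_0_var; [|left; apply Rmult_lt_0_compat; apply exp_pos].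
  rewrite <- exp_plus. unfold Rsqr. rewrite <- exp_plus.
  eapply Rle_trans; [replace (Cabs (d n) * Cabs (d n)) with (Cabs (d n) ^ 2) by ring; apply B|].
  assert (0 < / (INR n + 1)) by (apply Rinv_0_lt_compat; pose proof (pos_INR n); lra).
  assert (0 <= k * / (INR n + 1)) by (apply Rmult_le_pos; lra).
  apply exp_le_exp. lra.
Qed.

Lemma power_over_cube_cv (q : R) :
  q < 3 -> Un_cv (fun N => exp (q * ln (INR N + 1)) / INR N ^ 3) 0.
Proof.
  intros Hq eps He.
  destruct (INR_unbounded (exp (ln (eps / 8) / (q - 3)))) as [N0 HN0].
  exists (S N0). intros N HN.
  assert (HN1 : 1 <= INR N) by (change 1 with (INR 1); apply le_INR; lia).
  assert (HN2 : INR N0 <= INR N) by (apply le_INR; lia).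
  unfold Rdist. rewrite Rminus_0_r.
  assert (H3 : 0 < INR N ^ 3) by (apply pow_lt; lra).
  rewrite Rabs_pos_eq by (apply Rmult_le_pos; [left; apply exp_pos | left; apply Rinv_0_lt_compat; auto]).
  set (t := INR N + 1).
  assert (E : exp (q * ln t) = exp ((q - 3) * ln t) * t ^ 3).
  { replace (t ^ 3) with (exp (ln t) * exp (ln t) * exp (ln t))
      by (rewrite exp_ln by (unfold t; lra); ring).
    rewrite <- !exp_plus. f_equal. ring. }
  assert (Hsmall : exp ((q - 3) * ln t) < eps / 8).
  { rewrite <- (exp_ln (eps / 8)) by lra. apply exp_increasing.
    assert (Hl : ln (eps / 8) / (q - 3) < ln t).
    { rewrite <- (ln_exp (ln (eps / 8) / (q - 3))). apply ln_increasing; [apply exp_pos|unfold t; lra]. }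
    replace (ln (eps / 8)) with ((q - 3) * (ln (eps / 8) / (q - 3))) by (field; lra).
    nra. }
  apply Rmult_lt_reg_r with (INR N ^ 3); auto.
  unfold Rdiv. rewrite Rmult_assoc, Rinv_l, Rmult_1_r, E by lra.
  assert (t ^ 3 <= 8 * INR N ^ 3).
  { replace (8 * INR N ^ 3) with ((2 * INR N) ^ 3) by ring. apply pow_incr. unfold t; lra. }
  pose proof (exp_pos ((q - 3) * ln t)).
  apply Rle_lt_trans with (exp ((q - 3) * ln t) * (8 * INR N ^ 3)).
  - apply Rmult_le_compat_l; lra.
  - replace (eps * INR N ^ 3) with (eps / 8 * (8 * INR N ^ 3)) by field.
    apply Rmult_lt_compat_r; lra.
Qed.

(** * Laplace transform of the product of hyperbolic sines *)

Definition Ccosh (z : Cx) : Cx := ((Cexp z + Cexp (- z)) / RtoC 2)%C.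

(* [sinh (a x) / a], extended by continuity to [a = 0] *)
Definition Csinhc (a : Cx) (x : R) : Cx :=
  if Cx_eq_dec a (RtoC 0) then RtoC x else (Csinh (a * RtoC x)%C / a)%C.

Lemma RtoC_2_neq0 : RtoC 2 <> RtoC 0.
Proof. apply RtoC_neq0; lra. Qed.

Lemma Csinhc_0 (a : Cx) : Csinhc a 0 = RtoC 0.
Proof.
  unfold Csinhc. destruct (Cx_eq_dec a (RtoC 0)) as [E|E]; auto.
  unfold Csinh. replace (a * RtoC 0)%C with (RtoC 0) by ring.
  replace (- RtoC 0)%C with (RtoC 0) by ring.
  field. split; auto using RtoC_2_neq0.
Qed.

Lemma Ccosh_0 : Ccosh (RtoC 0) = RtoC 1.
Proof.
  unfold Ccosh. replace (- RtoC 0)%C with (RtoC 0) by ring. rewrite Cexp_0, <- RtoC_2.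
  field. apply RtoC_2_neq0.
Qed.

Lemma Csinhc_mul (a : Cx) (x : R) : (a * Csinhc a x)%C = Csinh (a * RtoC x)%C.
Proof.
  unfold Csinhc. destruct (Cx_eq_dec a (RtoC 0)) as [E|E].
  - subst. unfold Csinh. replace (RtoC 0 * RtoC x)%C with (RtoC 0) by ring.
    replace (- RtoC 0)%C with (RtoC 0) by ring. field. apply RtoC_2_neq0.
  - field; auto.
Qed.

Lemma is_derive_C_exp_lin (k : Cx) (x : R) :
  is_derive_C (fun t => Cexp (k * RtoC t)%C) x (k * Cexp (k * RtoC x)%C)%C.
Proof.
  eapply is_derive_C_eq.
  - apply is_derive_C_exp, is_derive_C_scal, is_derive_C_RtoC.
  - cbv beta. ring.
Qed.

Lemma is_derive_C_exp_pm (a : Cx) (s k : Cx) (x : R) :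
  is_derive_C (fun t => k * (Cexp (a * RtoC t)%C + s * Cexp (- (a * RtoC t))))%C x
    (k * (a * (Cexp (a * RtoC x)%C - s * Cexp (- (a * RtoC x)))))%C.
Proof.
  apply is_derive_C_scal. eapply is_derive_C_eq.
  - apply is_derive_C_add; [apply is_derive_C_exp_lin|].
    apply is_derive_C_scal. apply (is_derive_C_ext (fun t => Cexp ((- a) * RtoC t)%C)).
    + intros t; f_equal; ring.
    + apply is_derive_C_exp_lin.
  - replace (- a * RtoC x)%C with (- (a * RtoC x))%C by ring. ring.
Qed.

Lemma is_derive_C_sinhc (a : Cx) (x : R) :
  is_derive_C (Csinhc a) x (Ccosh (a * RtoC x)%C).
Proof.
  destruct (Cx_eq_dec a (RtoC 0)) as [E|E].
  - subst. apply (is_derive_C_ext RtoC).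
    + intros t. unfold Csinhc. destruct (Cx_eq_dec (RtoC 0) (RtoC 0)); congruence.
    + replace (RtoC 0 * RtoC x)%C with (RtoC 0) by ring. rewrite Ccosh_0. apply is_derive_C_RtoC.
  - eapply is_derive_C_eq.
    + apply (is_derive_C_ext (fun t => Cinv (RtoC 2 * a) * (Cexp (a * RtoC t)%C + (- RtoC 1) * Cexp (- (a * RtoC t))))%C).
      * intros t. unfold Csinhc. destruct (Cx_eq_dec a (RtoC 0)); [contradiction|].
        unfold Csinh. field. split; auto using RtoC_2_neq0.
      * apply is_derive_C_exp_pm.
    + unfold Ccosh. field. split; auto using RtoC_2_neq0.
Qed.

Lemma is_derive_C_cosh (a : Cx) (x : R) :
  is_derive_C (fun t => Ccosh (a * RtoC t)%C) x (a * a * Csinhc a x)%C.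
Proof.
  eapply is_derive_C_eq.
  - apply (is_derive_C_ext (fun t => Cinv (RtoC 2) * (Cexp (a * RtoC t)%C + RtoC 1 * Cexp (- (a * RtoC t))))%C).
    + intros t. unfold Ccosh. field. apply RtoC_2_neq0.
    + apply is_derive_C_exp_pm.
  - replace (a * a * Csinhc a x)%C with (a * (a * Csinhc a x))%C by ring.
    rewrite Csinhc_mul. unfold Csinh. field. apply RtoC_2_neq0.
Qed.

Lemma Ccosh_bound (a : Cx) (x : R) :
  0 <= x -> Cabs (Ccosh (a * RtoC x)%C) <= exp (Rabs (Re a) * x).
Proof.
  intros Hx. unfold Ccosh, Cdiv.
  rewrite Cabs_mul, Cabs_inv, Cabs_RtoC by apply RtoC_2_neq0.
  rewrite (Rabs_pos_eq 2) by lra.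
  pose proof (Cabs_add (Cexp (a * RtoC x)%C) (Cexp (- (a * RtoC x))%C)) as H.
  rewrite !Cabs_exp in H. simpl in H.
  pose proof (Rle_abs (Re a)). pose proof (Rle_abs (- Re a)) as H'. rewrite Rabs_Ropp in H'.
  assert (exp (Re a * x - Im a * 0) <= exp (Rabs (Re a) * x)) by (apply exp_le_exp; nra).
  assert (exp (- (Re a * x - Im a * 0)) <= exp (Rabs (Re a) * x)) by (apply exp_le_exp; nra).
  lra.
Qed.

Lemma Csinhc_bound (a : Cx) (x : R) :
  0 <= x -> Cabs (Csinhc a x) <= 2 * x * exp (Rabs (Re a) * x).
Proof.
  intros Hx.
  assert (B : forall t, 0 <= t <= x -> Cabs (Ccosh (a * RtoC t)%C) <= exp (Rabs (Re a) * x)).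
  { intros t Ht. eapply Rle_trans; [apply Ccosh_bound; lra|]. apply exp_le_exp.
    apply Rmult_le_compat_l; [apply Rabs_pos | lra]. }
  set (e := exp (Rabs (Re a) * x)) in *.
  assert (Hd : forall t, 0 <= t <= x -> is_derive (fun t => e * t) t e).
  { intros t _. auto_derive; auto. ring. }
  assert (H1 : Rabs (Re (Csinhc a x) - Re (Csinhc a 0)) <= e * x - e * 0).
  { apply (increment_bound (fun t => Re (Csinhc a t)) (fun t => e * t)
      (fun t => Re (Ccosh (a * RtoC t)%C)) (fun _ => e)); auto.
    - intros t Ht. apply (is_derive_C_sinhc a t).
    - intros t Ht. eapply Rle_trans; [apply Re_le_Cabs | auto]. }
  assert (H2 : Rabs (Im (Csinhc a x) - Im (Csinhc a 0)) <= e * x - e * 0).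
  { apply (increment_bound (fun t => Im (Csinhc a t)) (fun t => e * t)
      (fun t => Im (Ccosh (a * RtoC t)%C)) (fun _ => e)); auto.
    - intros t Ht. apply (is_derive_C_sinhc a t).
    - intros t Ht. eapply Rle_trans; [apply Im_le_Cabs | auto]. }
  rewrite Csinhc_0 in H1, H2. simpl in H1, H2. rewrite Rminus_0_r in H1, H2.
  pose proof (Cabs_le_sum (Csinhc a x)). lra.
Qed.

(* The coefficients solve the adjoint of the linear system satisfied by the
   four products of [sinh (a x) / a], [cosh (a x)] with [sinh (b x) / b], [cosh (b x)]. *)
Definition laplace_primitive (a b w : Cx) (x : R) : Cx :=
  (Cexp (- w * RtoC x)%C *
   (w * (w * w - a * a - b * b) * (Csinhc a x * Csinhc b x)
    + ((w * w - a * a + b * b) * (Ccosh (a * RtoC x)%C * Csinhc b x)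
    + ((w * w + a * a - b * b) * (Csinhc a x * Ccosh (b * RtoC x)%C)
    + RtoC 2 * w * (Ccosh (a * RtoC x)%C * Ccosh (b * RtoC x)%C)))))%C.

Definition laplace_denom (a b w : Cx) : Cx :=
  ((w - a - b) * (w + a + b) * (w - a + b) * (w + a - b))%C.

Lemma laplace_primitive_0 (a b w : Cx) : laplace_primitive a b w 0 = (RtoC 2 * w)%C.
Proof.
  unfold laplace_primitive. rewrite !Csinhc_0.
  replace (- w * RtoC 0)%C with (RtoC 0) by ring.
  replace (a * RtoC 0)%C with (RtoC 0) by ring.
  replace (b * RtoC 0)%C with (RtoC 0) by ring.
  rewrite Cexp_0, Ccosh_0. ring.
Qed.

Lemma is_derive_C_laplace_primitive (a b w : Cx) (x : R) :
  is_derive_C (laplace_primitive a b w) x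
    (- laplace_denom a b w * (Cexp (- w * RtoC x)%C * (Csinhc a x * Csinhc b x)))%C.
Proof.
  eapply is_derive_C_eq.
  - apply is_derive_C_mul; [apply is_derive_C_exp_lin|].
    pose proof (is_derive_C_sinhc a x). pose proof (is_derive_C_sinhc b x).
    pose proof (is_derive_C_cosh a x). pose proof (is_derive_C_cosh b x).
    do 3 (apply is_derive_C_add; [apply is_derive_C_scal, is_derive_C_mul; eassumption|]).
    apply is_derive_C_scal, is_derive_C_mul; eassumption.
  - unfold laplace_denom. cbv beta. rewrite RtoC_2. ring.
Qed.

Lemma is_lim_C_laplace_primitive (a b w : Cx) :
  Rabs (Re a) + Rabs (Re b) < Re w -> is_lim_C (laplace_primitive a b w) (RtoC 0).
Proof.
  intros Hw.
  set (k := (Re w - (Rabs (Re a) + Rabs (Re b))) / 2).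
  assert (Hk : 0 < k) by (unfold k; lra).
  destruct (sqr_le_exp k Hk) as [C [HC HCb]].
  assert (Hprod : forall f g : R -> Cx,
    (forall x, 0 <= x -> Cabs (f x) <= 2 * (1 + x) * exp (Rabs (Re a) * x)) ->
    (forall x, 0 <= x -> Cabs (g x) <= 2 * (1 + x) * exp (Rabs (Re b) * x)) ->
    is_lim_C (fun x => Cexp (- w * RtoC x)%C * (f x * g x))%C (RtoC 0)).
  { intros f g Hf Hg. apply (is_lim_C_zero_of_decay _ (4 * C) k Hk).
    intros x Hx. rewrite !Cabs_mul, Cabs_exp. simpl.
    specialize (Hf x Hx). specialize (Hg x Hx). specialize (HCb x Hx).
    apply Rle_trans with (exp (- Re w * x - - Im w * 0) *
      (2 * (1 + x) * exp (Rabs (Re a) * x) * (2 * (1 + x) * exp (Rabs (Re b) * x)))).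
    - apply Rmult_le_compat_l; [left; apply exp_pos|].
      apply Rmult_le_compat; auto using Cabs_pos.
    - replace (exp (- Re w * x - - Im w * 0) *
        (2 * (1 + x) * exp (Rabs (Re a) * x) * (2 * (1 + x) * exp (Rabs (Re b) * x))))
        with (4 * (1 + x) ^ 2 * (exp (- Re w * x - - Im w * 0) * exp (Rabs (Re a) * x) * exp (Rabs (Re b) * x))) by ring.
      rewrite <- !exp_plus.
      replace (- Re w * x - - Im w * 0 + Rabs (Re a) * x + Rabs (Re b) * x) with (- k * x + - k * x)
        by (unfold k; field).
      rewrite exp_plus.
      replace (4 * C * exp (- k * x)) with (4 * (C * exp (k * x)) * (exp (- k * x) * exp (- k * x))).
      + apply Rmult_le_compat_r; [left; apply Rmult_lt_0_compat; apply exp_pos | lra].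
      + replace (- k * x) with (- (k * x)) by ring. rewrite exp_Ropp. field.
        apply Rgt_not_eq, exp_pos. }
  assert (Hs : forall u x, 0 <= x -> Cabs (Csinhc u x) <= 2 * (1 + x) * exp (Rabs (Re u) * x)).
  { intros u x Hx. eapply Rle_trans; [apply Csinhc_bound; auto|].
    apply Rmult_le_compat_r; [left; apply exp_pos | lra]. }
  assert (Hc : forall u x, 0 <= x -> Cabs (Ccosh (u * RtoC x)%C) <= 2 * (1 + x) * exp (Rabs (Re u) * x)).
  { intros u x Hx. eapply Rle_trans; [apply Ccosh_bound; auto|].
    rewrite <- (Rmult_1_l (exp _)) at 1. apply Rmult_le_compat_r; [left; apply exp_pos | lra]. }
  pose proof (is_lim_C_mul _ _ _ _ (is_lim_C_const (w * (w * w - a * a - b * b))%C) (Hprod (Csinhc a) (Csinhc b) (Hs a) (Hs b))) as L1.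
  pose proof (is_lim_C_mul _ _ _ _ (is_lim_C_const (w * w - a * a + b * b)%C) (Hprod (fun x => Ccosh (a * RtoC x)%C) (Csinhc b) (Hc a) (Hs b))) as L2.
  pose proof (is_lim_C_mul _ _ _ _ (is_lim_C_const (w * w + a * a - b * b)%C) (Hprod (Csinhc a) (fun x => Ccosh (b * RtoC x)%C) (Hs a) (Hc b))) as L3.
  pose proof (is_lim_C_mul _ _ _ _ (is_lim_C_const (RtoC 2 * w)%C) (Hprod (fun x => Ccosh (a * RtoC x)%C) (fun x => Ccosh (b * RtoC x)%C) (Hc a) (Hc b))) as L4.
  pose proof (is_lim_C_add _ _ _ _ L1 (is_lim_C_add _ _ _ _ L2 (is_lim_C_add _ _ _ _ L3 L4))) as L.
  match type of L with is_lim_C _ ?l => replace l with (RtoC 0) in L by ring end.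
  assert (E : forall x, ltac:(match type of L with is_lim_C ?f _ => let r := eval cbv beta in (f x) in exact r end) = laplace_primitive a b w x)
    by (intros x; unfold laplace_primitive; ring).
  destruct L as [La Lb]. split; [eapply is_lim_ext; [|exact La] | eapply is_lim_ext; [|exact Lb]];
    intros x; cbv beta; rewrite <- E; reflexivity.
Qed.

Fixpoint Csum (u : nat -> Cx) (N : nat) : Cx :=
  match N with O => RtoC 0 | S M => (Csum u M + u M)%C end.

Lemma Cpartial_Csum (u : nat -> Cx) (N : nat) : Cpartial u N = Csum u (S N).
Proof.
  induction N as [|N IH]; simpl in *; [ring | rewrite IH; reflexivity].
Qed.

Lemma Csum_ext (u w : nat -> Cx) (N : nat) : (forall n, u n = w n) -> Csum u N = Csum w N.
Proof. intros H; induction N as [|N IH]; simpl; [|rewrite IH, H]; auto. Qed.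

Lemma Csum_scal (k : Cx) (u : nat -> Cx) (N : nat) :
  Csum (fun n => k * u n)%C N = (k * Csum u N)%C.
Proof. induction N as [|N IH]; simpl; [|rewrite IH]; ring. Qed.

Lemma is_derive_C_Csum (f f' : nat -> R -> Cx) (x : R) (N : nat) :
  (forall n, is_derive_C (f n) x (f' n x)) ->
  is_derive_C (fun t => Csum (fun n => f n t) N) x (Csum (fun n => f' n x) N).
Proof.
  intros H; induction N as [|N IH]; simpl.
  - apply is_derive_C_const.
  - apply is_derive_C_add; auto.
Qed.

Lemma is_lim_C_Csum (f : nat -> R -> Cx) (N : nat) :
  (forall n, is_lim_C (f n) (RtoC 0)) ->
  is_lim_C (fun t => Csum (fun n => f n t) N) (RtoC 0).
Proof.
  intros H; induction N as [|N IH]; simpl.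
  - apply is_lim_C_const.
  - replace (RtoC 0) with (RtoC 0 + RtoC 0)%C by ring. apply is_lim_C_add; auto.
Qed.

Lemma Cpow_nat_exp (w : Cx) (n : nat) : Cpow_nat (Cexp w) n = Cexp (RtoC (INR n) * w)%C.
Proof.
  induction n as [|n IH].
  - simpl. rewrite <- Cexp_0. f_equal; ring.
  - simpl Cpow_nat. rewrite IH, <- Cexp_add, S_INR, RtoC_add. f_equal. ring.
Qed.

(** * Remainder of the binomial series *)

Definition zexp (c : Cx) (x : R) : Cx := Cexp (RtoC (-2) * (c * RtoC x))%C.
Definition base (c : Cx) (x : R) : Cx := (RtoC 1 + zexp c x)%C.
Definition bpow (v c : Cx) (x : R) : Cx := Cpow (base c x) v.

Definition bcoef (v : Cx) (n : nat) : Cx :=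
  (poch v n * Cpow_nat (RtoC (-1)) n / RtoC (INR (Factorial.fact n)))%C.

Definition bsum (v c : Cx) (N : nat) (x : R) : Cx :=
  Csum (fun n => bcoef v n * Cpow_nat (zexp c x) n)%C N.

Definition bremainder (v c : Cx) (N : nat) (x : R) : Cx :=
  (RtoC 1 - bpow v c x * bsum v c N x)%C.

Lemma RtoC_INR_S_neq0 (n : nat) : RtoC (INR (S n)) <> RtoC 0.
Proof. apply RtoC_neq0, not_0_INR; lia. Qed.

Lemma RtoC_fact_neq0 (n : nat) : RtoC (INR (Factorial.fact n)) <> RtoC 0.
Proof. apply RtoC_neq0, INR_fact_neq_0. Qed.

Lemma bcoef_0 (v : Cx) : bcoef v 0 = RtoC 1.
Proof.
  unfold bcoef. simpl. field. apply RtoC_neq0; lra.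
Qed.

Lemma bcoef_S (v : Cx) (n : nat) :
  (bcoef v (S n) * RtoC (INR (S n)) = - (bcoef v n * (v + RtoC (INR n))))%C.
Proof.
  unfold bcoef. rewrite fact_simpl, mult_INR, RtoC_mul. cbn [poch Cpow_nat].
  replace (RtoC (-1)) with (- RtoC 1)%C by (apply Cx_eq; simpl; ring).
  pose proof (RtoC_INR_S_neq0 n). pose proof (RtoC_fact_neq0 n).
  field. auto.
Qed.

Lemma bcoef_growth (v : Cx) (q : R) :
  0 <= q -> Re v - 1 <= q ->
  exists K, 0 <= K /\ forall n, Cabs (bcoef v n) <= K * exp (q * ln (INR n + 1)).
Proof.
  intros Hq Hv. apply (binomial_coef_growth _ v); auto.
  - rewrite bcoef_0, Cabs_RtoC. apply Rabs_R1.
  - intros n. pose proof (f_equal Cabs (bcoef_S v n)) as E.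
    rewrite Cabs_mul, Cabs_opp, Cabs_mul, Cabs_RtoC in E.
    rewrite Rabs_pos_eq, S_INR in E by apply pos_INR. exact E.
Qed.

Lemma Cabs_zexp (c : Cx) (x : R) : Cabs (zexp c x) = exp (- (2 * Re c) * x).
Proof. unfold zexp. rewrite Cabs_exp. f_equal. simpl. ring. Qed.

Lemma zexp_pow (c : Cx) (x : R) (n : nat) :
  Cpow_nat (zexp c x) n = Cexp (RtoC (-2) * c * RtoC (INR n) * RtoC x)%C.
Proof. unfold zexp. rewrite Cpow_nat_exp. f_equal. ring. Qed.

Lemma Cabs_zexp_pow (c : Cx) (x : R) (n : nat) :
  Cabs (Cpow_nat (zexp c x) n) = exp (- (2 * Re c * INR n) * x).
Proof. rewrite zexp_pow, Cabs_exp. f_equal. simpl. ring. Qed.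

Lemma is_derive_C_zexp_pow (c : Cx) (x : R) (n : nat) :
  is_derive_C (fun t => Cpow_nat (zexp c t) n) x
    (RtoC (-2) * c * RtoC (INR n) * Cpow_nat (zexp c x) n)%C.
Proof.
  rewrite zexp_pow.
  apply (is_derive_C_ext (fun t => Cexp (RtoC (-2) * c * RtoC (INR n) * RtoC t)%C)).
  - intros t. symmetry. apply zexp_pow.
  - apply is_derive_C_exp_lin.
Qed.

Lemma is_derive_C_base (c : Cx) (x : R) :
  is_derive_C (base c) x (RtoC (-2) * c * zexp c x)%C.
Proof.
  unfold base. eapply is_derive_C_eq.
  - apply is_derive_C_add; [apply is_derive_C_const|].
    apply (is_derive_C_ext (fun t => Cexp (RtoC (-2) * c * RtoC t)%C)).
    + intros t. unfold zexp. f_equal. ring.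
    + apply is_derive_C_exp_lin.
  - unfold zexp. replace (RtoC (-2) * (c * RtoC x))%C with (RtoC (-2) * c * RtoC x)%C by ring. ring.
Qed.

Lemma is_derive_C_bpow (v c : Cx) (x : R) :
  0 < Re (base c x) ->
  is_derive_C (bpow v c) x
    (v * (RtoC (-2) * c * zexp c x / base c x) * bpow v c x)%C.
Proof.
  intros H. unfold bpow, Cpow. apply is_derive_C_exp, is_derive_C_scal, is_derive_C_log; auto.
  apply is_derive_C_base.
Qed.

(* The derivative telescopes: [(1+z) S_N' + v S_N] reduces to its top-degree term. *)
Lemma is_derive_C_bremainder (v c : Cx) (N : nat) (x : R) :
  0 < Re (base c x) ->
  is_derive_C (bremainder v c N) x
    (RtoC (-2) * c * RtoC (INR N) * bcoef v N * Cpow_nat (zexp c x) N * bpow v c x / base c x)%C.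
Proof.
  intros H. pose proof (Re_neq0 (base c x) ltac:(lra)) as Hb.
  induction N as [|N IH].
  - eapply is_derive_C_eq.
    + apply (is_derive_C_ext (fun _ => RtoC 1)).
      * intros t. unfold bremainder, bsum. simpl. ring.
      * apply is_derive_C_const.
    + simpl INR. field; auto.
  - eapply is_derive_C_eq.
    + apply (is_derive_C_ext (fun t => bremainder v c N t +
        (- bcoef v N) * (bpow v c t * Cpow_nat (zexp c t) N))%C).
      * intros t. unfold bremainder, bsum. simpl. ring.
      * apply is_derive_C_add; [exact IH|].
        apply is_derive_C_scal, is_derive_C_mul;
          [apply is_derive_C_bpow; auto | apply is_derive_C_zexp_pow].
    + replace (RtoC (-2) * c * RtoC (INR (S N)) * bcoef v (S N))%C with
        (RtoC (-2) * c * (bcoef v (S N) * RtoC (INR (S N))))%C by ring.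
      rewrite bcoef_S. cbn [Cpow_nat]. cbv beta.
      replace (zexp c x) with (base c x - RtoC 1)%C at 2 by (unfold base; ring).
      replace (Cpow_nat (zexp c x) N * zexp c x)%C with
        (Cpow_nat (zexp c x) N * (base c x - RtoC 1))%C by (unfold base; ring).
      field. auto.
Qed.

Lemma base_lower_bound (c : Cx) :
  0 < Re c -> exists dl, 0 < dl /\ forall x, 0 <= x -> dl <= Re (base c x).
Proof.
  intros Hc.
  set (x0 := / (2 * (1 + Rabs (Im c)))).
  pose proof (Rabs_pos (Im c)) as Hi.
  assert (Hx0 : 0 < x0) by (apply Rinv_0_lt_compat; lra).
  exists (1 - exp (- (2 * Re c) * x0)). split.
  - assert (exp (- (2 * Re c) * x0) < exp 0) by (apply exp_increasing; nra).
    rewrite exp_0 in H. lra.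
  - intros x Hx. unfold base. cbn [Cadd Re RtoC].
    destruct (Rle_lt_dec x x0) as [H|H].
    + assert (0 <= Re (zexp c x)).
      { unfold zexp. cbn [Cexp Re]. apply Rmult_le_pos; [left; apply exp_pos|].
        assert (Hb : Rabs (Im (RtoC (-2) * (c * RtoC x))%C) <= 1).
        { replace (Im (RtoC (-2) * (c * RtoC x))%C) with (- (2 * x * Im c)) by (simpl; ring).
          rewrite Rabs_Ropp, !Rabs_mult, (Rabs_pos_eq 2), (Rabs_pos_eq x) by lra.
          apply Rle_trans with (2 * x0 * Rabs (Im c)).
          - apply Rmult_le_compat_r; lra.
          - unfold x0. apply Rmult_le_reg_r with (1 + Rabs (Im c)); [lra|].
            replace (2 * / (2 * (1 + Rabs (Im c))) * Rabs (Im c) * (1 + Rabs (Im c)))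
              with (Rabs (Im c)) by (field; lra). lra. }
        apply Rabs_le_between in Hb. pose proof PI2_1.
        apply cos_ge_0; lra. }
      pose proof (exp_pos (- (2 * Re c) * x0)). lra.
    + pose proof (Re_le_Cabs (zexp c x)) as Hz. rewrite Cabs_zexp in Hz.
      assert (exp (- (2 * Re c) * x) <= exp (- (2 * Re c) * x0)) by (apply exp_le_exp; nra).
      apply Rabs_le_between in Hz. lra.
Qed.

Lemma bpow_bound (v c : Cx) :
  0 < Re c -> exists K, 0 <= K /\ forall x, 0 <= x -> Cabs (bpow v c x) <= K.
Proof.
  intros Hc. destruct (base_lower_bound c Hc) as [dl [Hdl Hb]].
  set (l := ln 2 + Rabs (ln dl)).
  exists (exp (Rabs (Re v) * l + Rabs (Im v) * 2)). split; [left; apply exp_pos|].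
  intros x Hx. specialize (Hb x Hx).
  unfold bpow, Cpow. rewrite Cabs_exp. apply exp_le_exp.
  set (b := base c x) in *.
  assert (H1 : dl <= Cabs b).
  { pose proof (Re_le_Cabs b) as H. apply Rabs_le_between in H. lra. }
  assert (H2 : Cabs b <= 2).
  { unfold b, base. eapply Rle_trans; [apply Cabs_add|].
    rewrite Cabs_RtoC, Rabs_R1, Cabs_zexp.
    assert (exp (- (2 * Re c) * x) <= exp 0) by (apply exp_le_exp; nra).
    rewrite exp_0 in H. lra. }
  assert (H3 : Rabs (ln (Cabs b)) <= l).
  { assert (ln dl <= ln (Cabs b)) by (apply ln_le; lra).
    assert (ln (Cabs b) <= ln 2) by (apply ln_le; lra).
    pose proof (Rabs_pos (ln dl)). pose proof (Rle_abs (- ln dl)) as H'. rewrite Rabs_Ropp in H'.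
    assert (0 <= ln 2) by (rewrite <- ln_1; apply ln_le; lra).
    unfold l. apply Rabs_le; lra. }
  assert (H4 : Rabs (Carg b) <= 2).
  { unfold Carg. destruct (Rlt_dec 0 (Re b)); [|lra].
    pose proof (atan_bound (Im b / Re b)). pose proof PI_4. apply Rabs_le; lra. }
  cbn [Cmul Re Clog Im].
  eapply Rle_trans; [apply Rle_abs|]. eapply Rle_trans; [apply Rabs_triang|].
  rewrite Rabs_Ropp, !Rabs_mult.
  apply Rplus_le_compat; apply Rmult_le_compat_l; auto using Rabs_pos.
Qed.

Lemma bpow_opp (v c : Cx) (x : R) : (bpow (- v)%C c x * bpow v c x)%C = RtoC 1.
Proof.
  unfold bpow, Cpow. rewrite <- Cexp_add, <- Cexp_0. f_equal. ring.
Qed.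

Lemma is_lim_C_ext (f g : R -> Cx) (l : Cx) :
  (forall t, f t = g t) -> is_lim_C f l -> is_lim_C g l.
Proof.
  intros H [H1 H2]; split; eapply is_lim_ext; try eassumption;
    intros t; cbv beta; rewrite H; auto.
Qed.

Lemma is_lim_C_zexp_pow (c : Cx) (n : nat) :
  0 < Re c -> (1 <= n)%nat -> is_lim_C (fun x => Cpow_nat (zexp c x) n) (RtoC 0).
Proof.
  intros Hc Hn.
  assert (1 <= INR n) by (change 1 with (INR 1); apply le_INR; auto).
  apply (is_lim_C_zero_of_decay _ 1 (2 * Re c * INR n)); [nra|].
  intros x _. rewrite Cabs_zexp_pow. lra.
Qed.

Lemma is_lim_C_bpow (v c : Cx) : 0 < Re c -> is_lim_C (bpow v c) (RtoC 1).
Proof.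
  intros Hc. rewrite <- Cexp_0. replace (RtoC 0) with (v * RtoC 0)%C by ring.
  unfold bpow, Cpow. apply is_lim_C_exp, is_lim_C_mul; [apply is_lim_C_const|].
  apply is_lim_C_log. replace (RtoC 1) with (RtoC 1 + RtoC 0)%C by ring.
  unfold base. apply is_lim_C_add; [apply is_lim_C_const|].
  apply (is_lim_C_ext (fun x => Cpow_nat (zexp c x) 1)).
  - intros t. simpl. ring.
  - apply is_lim_C_zexp_pow; auto.
Qed.

Lemma is_lim_C_bremainder (v c : Cx) (N : nat) :
  0 < Re c -> (1 <= N)%nat -> is_lim_C (bremainder v c N) (RtoC 0).
Proof.
  intros Hc HN.
  assert (HS : is_lim_C (bsum v c N) (RtoC 1)).
  { induction HN as [|N HN IH]; unfold bsum in *; cbn [Csum].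
    - eapply is_lim_C_ext; [|apply is_lim_C_const].
      intros t. cbv beta. rewrite bcoef_0. simpl. ring.
    - replace (RtoC 1) with (RtoC 1 + bcoef v N * RtoC 0)%C by ring.
      apply is_lim_C_add; auto.
      apply is_lim_C_mul; [apply is_lim_C_const|]. apply is_lim_C_zexp_pow; auto. }
  pose proof (is_lim_C_add _ _ _ _ (is_lim_C_const (RtoC 1))
    (is_lim_C_mul _ _ _ _ (is_lim_C_const (- RtoC 1)%C)
       (is_lim_C_mul _ _ _ _ (is_lim_C_bpow v c Hc) HS))) as L.
  replace (RtoC 1 + - RtoC 1 * (RtoC 1 * RtoC 1))%C with (RtoC 0) in L by ring.
  eapply is_lim_C_ext; [|exact L]. intros t. unfold bremainder. cbv beta. ring.
Qed.

Lemma bremainder_bound (v c : Cx) :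
  0 < Re c -> exists K, 0 <= K /\ forall N x, (1 <= N)%nat -> 0 <= x ->
    Cabs (bremainder v c N x) <= K * Cabs (bcoef v N) * exp (- (2 * Re c * INR N) * x).
Proof.
  intros Hc.
  destruct (base_lower_bound c Hc) as [dl [Hdl Hb]].
  destruct (bpow_bound v c Hc) as [K [HK Hp]].
  set (C1 := Cabs c * K / (dl * Re c)).
  assert (HC1 : 0 <= C1).
  { apply Rdiv_le_0_compat; [apply Rmult_le_pos; auto using Cabs_pos | nra]. }
  exists (2 * C1). split; [lra|]. intros N x HN Hx.
  assert (HN1 : 1 <= INR N) by (change 1 with (INR 1); apply le_INR; auto).
  set (A := C1 * Cabs (bcoef v N)).
  assert (HA : 0 <= A) by (apply Rmult_le_pos; auto using Cabs_pos).
  set (m := 2 * Re c * INR N). assert (Hm : 0 < m) by (unfold m; nra).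
  set (g' := fun x => (RtoC (-2) * c * RtoC (INR N) * bcoef v N * Cpow_nat (zexp c x) N * bpow v c x / base c x)%C).
  assert (Hg : forall t, 0 <= t -> is_derive_C (bremainder v c N) t (g' t)).
  { intros t Ht. apply is_derive_C_bremainder. specialize (Hb t Ht). lra. }
  assert (Hg' : forall t, 0 <= t -> Cabs (g' t) <= A * m * exp (- m * t)).
  { intros t Ht. specialize (Hb t Ht). specialize (Hp t Ht).
    assert (Hq : dl <= Cabs (base c t)).
    { pose proof (Re_le_Cabs (base c t)) as H. apply Rabs_le_between in H. lra. }
    unfold g', Cdiv. rewrite !Cabs_mul, Cabs_inv by (apply Re_neq0; lra).
    rewrite Cabs_zexp_pow, !Cabs_RtoC, (Rabs_pos_eq (INR N)) by lra.
    rewrite Rabs_left by lra. fold m.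
    apply Rle_trans with (- -2 * Cabs c * INR N * Cabs (bcoef v N) * exp (- m * t) * (K * / dl)).
    - rewrite Rmult_assoc. apply Rmult_le_compat_l.
      + pose proof (Cabs_pos c). pose proof (Cabs_pos (bcoef v N)).
        repeat apply Rmult_le_pos; try lra. left; apply exp_pos.
      + apply Rmult_le_compat; auto using Cabs_pos.
        * left; apply Rinv_0_lt_compat; lra.
        * apply Rinv_le_contravar; auto.
    - right. unfold A, C1, m. field. lra. }
  destruct (is_lim_C_bremainder v c N Hc HN) as [L1 L2].
  assert (HR : Rabs (Re (bremainder v c N x)) <= A * exp (- m * x)).
  { apply (decay_of_derivative_decay (fun t => Re (bremainder v c N t)) (fun t => Re (g' t))); auto.
    - intros t Ht; apply (Hg t Ht).
    - intros t Ht. eapply Rle_trans; [apply Re_le_Cabs | auto]. }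
  assert (HI : Rabs (Im (bremainder v c N x)) <= A * exp (- m * x)).
  { apply (decay_of_derivative_decay (fun t => Im (bremainder v c N t)) (fun t => Im (g' t))); auto.
    - intros t Ht; apply (Hg t Ht).
    - intros t Ht. eapply Rle_trans; [apply Im_le_Cabs | auto]. }
  pose proof (Cabs_le_sum (bremainder v c N x)).
  replace (2 * C1 * Cabs (bcoef v N)) with (2 * A) by (unfold A; ring). lra.
Qed.

(** * Term-by-term integration *)

Definition freq (v c : Cx) (n : nat) : Cx := ((v + RtoC 2 * RtoC (INR n)) * c)%C.

Definition kernel (v a b c : Cx) (x : R) : Cx :=
  (Cexp (- (v * c) * RtoC x)%C * (Csinhc a x * Csinhc b x))%C.

Definition integrand (v a b c : Cx) (x : R) : Cx :=
  (kernel v a b c x * bpow (- v)%C c x)%C.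

Definition laplace_sum (v a b c : Cx) (N : nat) : Cx :=
  Csum (fun n => bcoef v n * (RtoC 2 * freq v c n / laplace_denom a b (freq v c n)))%C N.

Definition approx_primitive (v a b c : Cx) (N : nat) (x : R) : Cx :=
  Csum (fun n => - (bcoef v n / laplace_denom a b (freq v c n)) *
                 laplace_primitive a b (freq v c n) x)%C N.

Lemma laplace_denom_neq0 (a b w : Cx) :
  Rabs (Re a) + Rabs (Re b) < Re w -> laplace_denom a b w <> RtoC 0.
Proof.
  intros H.
  pose proof (Rle_abs (Re a)). pose proof (Rle_abs (- Re a)) as Ha. rewrite Rabs_Ropp in Ha.
  pose proof (Rle_abs (Re b)). pose proof (Rle_abs (- Re b)) as Hb. rewrite Rabs_Ropp in Hb.
  unfold laplace_denom. repeat apply Cmul_neq0; apply Re_neq0; simpl; lra.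
Qed.

Lemma Re_freq (v a b c : Cx) (n : nat) :
  0 < Re c -> Rabs (Re a) + Rabs (Re b) < Re (v * c)%C ->
  Rabs (Re a) + Rabs (Re b) < Re (freq v c n).
Proof.
  intros Hc H. unfold freq. simpl in *. pose proof (pos_INR n). nra.
Qed.

Lemma kernel_bound (v a b c : Cx) (x : R) :
  Rabs (Re a) + Rabs (Re b) < Re (v * c)%C -> 0 <= x ->
  Cabs (kernel v a b c x) <= 4 * x ^ 2.
Proof.
  intros H Hx. unfold kernel. rewrite !Cabs_mul, Cabs_exp.
  replace (Re (- (v * c) * RtoC x)%C) with (- Re (v * c)%C * x) by (simpl; ring).
  set (r := Re (v * c)%C) in *.
  apply Rle_trans with (exp (- r * x) *
    (2 * x * exp (Rabs (Re a) * x) * (2 * x * exp (Rabs (Re b) * x)))).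
  - apply Rmult_le_compat_l; [left; apply exp_pos|].
    apply Rmult_le_compat; auto using Cabs_pos, Csinhc_bound.
  - replace (exp (- r * x) * (2 * x * exp (Rabs (Re a) * x) * (2 * x * exp (Rabs (Re b) * x))))
      with (4 * x ^ 2 * (exp (- r * x) * exp (Rabs (Re a) * x) * exp (Rabs (Re b) * x))) by ring.
    rewrite <- !exp_plus.
    assert (exp (- r * x + Rabs (Re a) * x + Rabs (Re b) * x) <= exp 0) by (apply exp_le_exp; nra).
    rewrite exp_0 in H0. nra.
Qed.

Lemma kernel_mul_bsum (v a b c : Cx) (N : nat) (x : R) :
  (kernel v a b c x * bsum v c N x)%C =
  Csum (fun n => bcoef v n * (Cexp (- freq v c n * RtoC x)%C * (Csinhc a x * Csinhc b x)))%C N.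
Proof.
  unfold bsum. rewrite <- Csum_scal. apply Csum_ext. intros n.
  rewrite zexp_pow. unfold kernel.
  replace (Cexp (- freq v c n * RtoC x)%C) with
    (Cexp (- (v * c) * RtoC x)%C * Cexp (RtoC (-2) * c * RtoC (INR n) * RtoC x)%C)%C.
  - ring.
  - rewrite <- Cexp_add. f_equal. unfold freq.
    replace (RtoC (-2)) with (- RtoC 2)%C by (rewrite <- RtoC_opp; reflexivity). ring.
Qed.

Lemma is_derive_C_approx_primitive (v a b c : Cx) (N : nat) (x : R) :
  0 < Re c -> Rabs (Re a) + Rabs (Re b) < Re (v * c)%C ->
  is_derive_C (approx_primitive v a b c N) x (kernel v a b c x * bsum v c N x)%C.
Proof.
  intros Hc H. rewrite kernel_mul_bsum. unfold approx_primitive.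
  apply (is_derive_C_Csum (fun n t => - (bcoef v n / laplace_denom a b (freq v c n)) *
                 laplace_primitive a b (freq v c n) t)%C
     (fun n t => bcoef v n * (Cexp (- freq v c n * RtoC t)%C * (Csinhc a t * Csinhc b t)))%C).
  intros n. eapply is_derive_C_eq.
  - apply is_derive_C_scal, is_derive_C_laplace_primitive.
  - field. apply laplace_denom_neq0, Re_freq; auto.
Qed.

Lemma approx_primitive_0 (v a b c : Cx) (N : nat) :
  (- approx_primitive v a b c N 0)%C = laplace_sum v a b c N.
Proof.
  unfold approx_primitive, laplace_sum.
  replace (- _)%C with (- RtoC 1 * Csum (fun n => - (bcoef v n / laplace_denom a b (freq v c n)) *
                 laplace_primitive a b (freq v c n) 0)%C N)%C by ring.
  rewrite <- Csum_scal. apply Csum_ext. intros n.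
  rewrite laplace_primitive_0. unfold Cdiv. ring.
Qed.

Lemma is_derive_C_kernel (v a b c : Cx) (x : R) : exists l, is_derive_C (kernel v a b c) x l.
Proof.
  eexists. unfold kernel.
  apply is_derive_C_mul; [apply is_derive_C_exp_lin|].
  apply is_derive_C_mul; apply is_derive_C_sinhc.
Qed.

Lemma is_derive_C_bsum (v c : Cx) (N : nat) (x : R) : exists l, is_derive_C (bsum v c N) x l.
Proof.
  eexists. unfold bsum.
  apply (is_derive_C_Csum (fun n t => bcoef v n * Cpow_nat (zexp c t) n)%C
    (fun n t => bcoef v n * (RtoC (-2) * c * RtoC (INR n) * Cpow_nat (zexp c t) n))%C).
  intros n. apply is_derive_C_scal, is_derive_C_zexp_pow.
Qed.

Lemma integrand_continuous (v a b c k : Cx) (x : R) :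
  0 < Re c -> 0 <= x ->
  continuous (fun t => Re (k * integrand v a b c t)%C) x /\
  continuous (fun t => Im (k * integrand v a b c t)%C) x.
Proof.
  intros Hc Hx. destruct (base_lower_bound c Hc) as [dl [Hdl Hb]]. specialize (Hb x Hx).
  destruct (is_derive_C_kernel v a b c x) as [l Hl].
  eapply (is_derive_C_continuous (fun t => k * integrand v a b c t)%C).
  apply is_derive_C_scal. unfold integrand. apply is_derive_C_mul; [exact Hl|].
  apply is_derive_C_bpow. lra.
Qed.

Lemma integrand_sub_approx_bound (v a b c : Cx) :
  0 < Re c -> Rabs (Re a) + Rabs (Re b) < Re (v * c)%C ->
  exists K, 0 <= K /\ forall N x, (1 <= N)%nat -> 0 <= x ->
    Cabs (integrand v a b c x - kernel v a b c x * bsum v c N x)%C <=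
    K * Cabs (bcoef v N) * (x ^ 2 * exp (- (2 * Re c * INR N) * x)).
Proof.
  intros Hc H.
  destruct (bpow_bound (- v)%C c Hc) as [K1 [HK1 Hp]].
  destruct (bremainder_bound v c Hc) as [K2 [HK2 Hr]].
  exists (4 * K1 * K2). split; [repeat apply Rmult_le_pos; lra|].
  intros N x HN Hx.
  replace (integrand v a b c x - kernel v a b c x * bsum v c N x)%C with
    (kernel v a b c x * (bpow (- v)%C c x * bremainder v c N x))%C.
  - rewrite !Cabs_mul.
    apply Rle_trans with (4 * x ^ 2 * (K1 * (K2 * Cabs (bcoef v N) * exp (- (2 * Re c * INR N) * x)))).
    + apply Rmult_le_compat; auto using Cabs_pos, kernel_bound.
      * apply Rmult_le_pos; apply Cabs_pos.
      * apply Rmult_le_compat; auto using Cabs_pos.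
    + right; ring.
  - unfold integrand, bremainder.
    replace (bpow (- v)%C c x * (RtoC 1 - bpow v c x * bsum v c N x))%C with
      (bpow (- v)%C c x - (bpow (- v)%C c x * bpow v c x) * bsum v c N x)%C by ring.
    rewrite bpow_opp. ring.
Qed.

Lemma integrand_integral_Re (v a b c k : Cx) :
  Re v < 4 -> 0 < Re c -> Rabs (Re a) + Rabs (Re b) < Re (v * c)%C ->
  exists L, Un_cv (fun N => Re (k * laplace_sum v a b c N)%C) L /\
    forall eps, 0 < eps -> exists M, forall B, M <= B -> 0 <= B ->
      Rabs (RInt (fun x => Re (k * integrand v a b c x)%C) 0 B - L) < eps.
Proof.
  intros Hv Hc H.
  destruct (integrand_sub_approx_bound v a b c Hc H) as [K [HK Hb]].
  destruct (improper_integral_by_approximation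
    (fun x => Re (k * integrand v a b c x)%C)
    (fun N x => Re (k * approx_primitive v a b c N x)%C)
    (fun N x => Re (k * (kernel v a b c x * bsum v c N x))%C)
    (fun N => Cabs k * (K * Cabs (bcoef v N)))
    (fun N => 2 * Re c * INR N)) as [L [H1 H2]].
  - intros x Hx. exact (proj1 (integrand_continuous v a b c k x Hc Hx)).
  - intros N x Hx.
    exact (proj1 (is_derive_C_scal k _ _ _ (is_derive_C_approx_primitive v a b c N x Hc H))).
  - intros N x Hx. destruct (is_derive_C_kernel v a b c x) as [l Hl].
    destruct (is_derive_C_bsum v c N x) as [l' Hl'].
    exact (proj1 (is_derive_C_continuous _ _ _
      (is_derive_C_scal k _ _ _ (is_derive_C_mul _ _ _ _ _ Hl Hl')))).
  - intros N.
    assert (L : is_lim_C (fun x => k * approx_primitive v a b c N x)%C (k * RtoC 0)%C).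
    { apply is_lim_C_mul; [apply is_lim_C_const|]. unfold approx_primitive.
      apply (is_lim_C_Csum (fun n t => - (bcoef v n / laplace_denom a b (freq v c n)) *
                 laplace_primitive a b (freq v c n) t)%C).
      intros n. replace (RtoC 0) with (- (bcoef v n / laplace_denom a b (freq v c n)) * RtoC 0)%C by ring.
      apply is_lim_C_mul; [apply is_lim_C_const|].
      apply is_lim_C_laplace_primitive, Re_freq; auto. }
    replace (k * RtoC 0)%C with (RtoC 0) in L by ring. exact (proj1 L).
  - intros N HN.
    assert (1 <= INR N) by (change 1 with (INR 1); apply le_INR; auto).
    split; [repeat apply Rmult_le_pos; auto using Cabs_pos|]. split; [nra|].
    intros x Hx.
    replace (Re _ - Re _) with (Re (k * (integrand v a b c x - kernel v a b c x * bsum v c N x))%C)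
      by (simpl; ring).
    eapply Rle_trans; [apply Re_le_Cabs|]. rewrite Cabs_mul, Rmult_assoc.
    apply Rmult_le_compat_l; auto using Cabs_pos.
  - set (q := Rmax 0 (Re v - 1)).
    assert (Hq : q < 3) by (apply Rmax_lub_lt; lra).
    destruct (bcoef_growth v q) as [K' [HK' Hg]]; [apply Rmax_l | apply Rmax_r |].
    set (k0 := 2 * (Cabs k * K * K') / (8 * Re c ^ 3)).
    assert (Hc3 : 0 < Re c ^ 3) by (apply pow_lt; auto).
    assert (Hk0 : 0 <= k0).
    { apply Rdiv_le_0_compat; [|lra]. repeat apply Rmult_le_pos; auto using Cabs_pos; lra. }
    intros eps He.
    destruct (power_over_cube_cv q Hq (eps / (k0 + 1))) as [N0 HN0];
      [apply Rdiv_lt_0_compat; lra|].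
    exists (S N0). intros N HN. specialize (HN0 N ltac:(lia)).
    unfold Rdist in *. rewrite Rminus_0_r in *.
    assert (HN1 : 1 <= INR N) by (change 1 with (INR 1); apply le_INR; lia).
    assert (HN3 : 0 < INR N ^ 3) by (apply pow_lt; lra).
    pose proof (Cabs_pos k). pose proof (Cabs_pos (bcoef v N)).
    rewrite Rabs_pos_eq in HN0 |- *.
    + apply Rle_lt_trans with (k0 * (exp (q * ln (INR N + 1)) / INR N ^ 3)).
      * replace (k0 * (exp (q * ln (INR N + 1)) / INR N ^ 3)) with
          (2 * (Cabs k * K) / (8 * Re c ^ 3 * INR N ^ 3) * (K' * exp (q * ln (INR N + 1))))
          by (unfold k0; field; lra).
        replace (2 * (Cabs k * (K * Cabs (bcoef v N))) / (2 * Re c * INR N) ^ 3) with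
          (2 * (Cabs k * K) / (8 * Re c ^ 3 * INR N ^ 3) * Cabs (bcoef v N)) by (field; lra).
        apply Rmult_le_compat_l; [|apply Hg].
        apply Rdiv_le_0_compat; [repeat apply Rmult_le_pos; lra |].
        apply Rmult_lt_0_compat; lra.
      * apply Rle_lt_trans with (k0 * (eps / (k0 + 1))); [apply Rmult_le_compat_l; lra|].
        apply Rmult_lt_reg_r with (k0 + 1); [lra|].
        replace (k0 * (eps / (k0 + 1)) * (k0 + 1)) with (k0 * eps) by (field; lra). lra.
    + apply Rdiv_le_0_compat; auto. left; apply exp_pos.
    + apply Rdiv_le_0_compat; [repeat apply Rmult_le_pos; lra|].
      apply pow_lt. nra.
  - exists L. split; auto.
    eapply Un_cv_ext; [|exact H1]. intros N. cbv beta. rewrite <- approx_primitive_0. simpl. ring.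
Qed.

Lemma integrand_integral (v a b c : Cx) :
  Re v < 4 -> 0 < Re c -> Rabs (Re a) + Rabs (Re b) < Re (v * c)%C ->
  exists L : Cx, forall k : Cx,
    Un_cv (fun N => Re (k * laplace_sum v a b c N)%C) (Re (k * L)%C) /\
    forall eps, 0 < eps -> exists M, forall B, M <= B -> 0 <= B ->
      Rabs (RInt (fun x => Re (k * integrand v a b c x)%C) 0 B - Re (k * L)%C) < eps.
Proof.
  intros Hv Hc H.
  destruct (integrand_integral_Re v a b c (RtoC 1) Hv Hc H) as [L1 [H1 _]].
  destruct (integrand_integral_Re v a b c (mkC 0 (-1)) Hv Hc H) as [L2 [H2 _]].
  exists (mkC L1 L2). intros k.
  destruct (integrand_integral_Re v a b c k Hv Hc H) as [l [H3 H4]].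
  replace (Re (k * mkC L1 L2)%C) with l; [auto|].
  apply (UL_sequence _ _ _ H3).
  apply (Un_cv_ext (fun N => Re k * Re (RtoC 1 * laplace_sum v a b c N)%C -
                       Im k * Re (mkC 0 (-1) * laplace_sum v a b c N)%C)).
  - intros N. simpl. ring.
  - apply CV_minus; apply CV_mult; auto; intros eps He; exists O; intros;
      unfold Rdist; rewrite Rminus_diag, Rabs_R0; auto.
Qed.

(** * The hypergeometric series *)

Lemma poch_neq0 (z : Cx) (n : nat) : notZ0m z -> poch z n <> RtoC 0.
Proof.
  intros H; induction n as [|n IH]; cbn [poch].
  - apply RtoC_neq0; lra.
  - apply Cmul_neq0; auto. intros E. apply (H n). rewrite RtoC_opp.
    replace z with ((z + RtoC (INR n)) - RtoC (INR n))%C by ring. rewrite E. ring.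
Qed.

Lemma poch_shift (z : Cx) (n : nat) :
  (z * poch (RtoC 1 + z) n)%C = (poch z n * (z + RtoC (INR n)))%C.
Proof.
  induction n as [|n IH].
  - simpl. ring.
  - cbn [poch]. rewrite S_INR, RtoC_add.
    replace (z * (poch (RtoC 1 + z) n * (RtoC 1 + z + RtoC (INR n))))%C
      with (z * poch (RtoC 1 + z) n * (RtoC 1 + z + RtoC (INR n)))%C by ring.
    rewrite IH. ring.
Qed.

Lemma poch_ratio (z : Cx) (n : nat) :
  notZ0m (RtoC 1 + z)%C -> (z + RtoC (INR n))%C <> RtoC 0 ->
  (poch z n * Cinv (poch (RtoC 1 + z) n) = z * Cinv (z + RtoC (INR n)))%C.
Proof.
  intros H Hn. pose proof (poch_neq0 _ n H). pose proof (poch_shift z n) as E.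
  replace (poch z n) with (z * poch (RtoC 1 + z) n * Cinv (z + RtoC (INR n)))%C
    by (rewrite E; field; auto).
  field. auto.
Qed.

Lemma poch_ratio_inv (z : Cx) (n : nat) :
  notZ0m z -> (poch (RtoC 1 + z) n * Cinv (poch z n) = (z + RtoC (INR n)) * Cinv z)%C.
Proof.
  intros H. pose proof (poch_neq0 _ n H). pose proof (poch_shift z n) as E.
  assert (z <> RtoC 0).
  { intros E0. apply (H O). rewrite E0. f_equal. simpl. ring. }
  replace (poch (RtoC 1 + z)%C n) with (z * poch (RtoC 1 + z) n * Cinv z)%C by (field; auto).
  rewrite E. field. auto.
Qed.

Lemma Cpow_2_add_1 (v : Cx) : Cpow (RtoC 2) (v + RtoC 1)%C = (Cpow (RtoC 2) v * RtoC 2)%C.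
Proof.
  unfold Cpow.
  replace ((v + RtoC 1) * Clog (RtoC 2))%C with (v * Clog (RtoC 2) + Clog (RtoC 2))%C by ring.
  rewrite Cexp_add. f_equal.
  unfold Clog. rewrite Cabs_RtoC, Rabs_pos_eq by lra.
  unfold Carg. simpl. destruct (Rlt_dec 0 2); [|lra].
  unfold Rdiv. rewrite Rmult_0_l, atan_0. apply Cx_eq; simpl.
  - rewrite exp_ln, cos_0 by lra. ring.
  - rewrite sin_0. ring.
Qed.

Lemma integrand_eq (v a b c : Cx) (x : R) :
  (Csinh (a * RtoC x)%C * Csinh (b * RtoC x)%C / cosh_pow v c x)%C =
  (a * b * Cpow (RtoC 2) v * integrand v a b c x)%C.
Proof.
  rewrite <- !Csinhc_mul. unfold integrand, kernel, cosh_pow.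
  fold (zexp c x). fold (base c x). fold (bpow v c x).
  assert (E1 : Cpow (RtoC 2) (- v)%C = Cinv (Cpow (RtoC 2) v)).
  { unfold Cpow. rewrite Cexp_inv. f_equal. ring. }
  assert (E2 : Cexp (- (v * c) * RtoC x)%C = Cinv (Cexp (v * (c * RtoC x))%C)).
  { rewrite Cexp_inv. f_equal. ring. }
  assert (E3 : bpow (- v)%C c x = Cinv (bpow v c x)).
  { unfold bpow, Cpow. rewrite Cexp_inv. f_equal. ring. }
  rewrite E1, E2, E3. field.
  repeat split; apply Cexp_neq0.
Qed.

Lemma poch_ratio_half (c u s : Cx) (n : nat) :
  c <> RtoC 0 -> (RtoC 2 * c * s)%C = u -> notZ0m (RtoC 1 + s)%C ->
  (u + RtoC 2 * RtoC (INR n) * c)%C <> RtoC 0 ->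
  (poch s n * Cinv (poch (RtoC 1 + s) n) = u * Cinv (u + RtoC 2 * RtoC (INR n) * c))%C.
Proof.
  intros Hc Hu Hs Hn. subst u.
  assert (Hsn : (s + RtoC (INR n))%C <> RtoC 0).
  { intros E. apply Hn.
    replace (RtoC 2 * c * s + RtoC 2 * RtoC (INR n) * c)%C with (RtoC 2 * c * (s + RtoC (INR n)))%C by ring.
    rewrite E. ring. }
  rewrite poch_ratio by auto.
  replace (RtoC 2 * c * s + RtoC 2 * RtoC (INR n) * c)%C with (RtoC 2 * c * (s + RtoC (INR n)))%C by ring.
  field. repeat split; auto using RtoC_2_neq0.
Qed.

Lemma hyp_term_laplace (v a b c s3 s4 s5 s6 : Cx) (n : nat) :
  0 < Re c -> Rabs (Re a) + Rabs (Re b) < Re (v * c)%C ->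
  let h := (v / RtoC 2)%C in
  (RtoC 2 * c * s3 = v * c - a - b)%C -> (RtoC 2 * c * s4 = v * c - a + b)%C ->
  (RtoC 2 * c * s5 = v * c + a + b)%C -> (RtoC 2 * c * s6 = v * c + a - b)%C ->
  notZ0m h ->
  notZ0m (RtoC 1 + s3)%C -> notZ0m (RtoC 1 + s4)%C ->
  notZ0m (RtoC 1 + s5)%C -> notZ0m (RtoC 1 + s6)%C ->
  hyp_term [v; RtoC 1 + h; s3; s5; s4; s6]%C
           [h; RtoC 1 + s3; RtoC 1 + s5; RtoC 1 + s4; RtoC 1 + s6]%C (RtoC (-1)) n =
  (laplace_denom a b (v * c)%C / (RtoC 2 * v * c) *
   (bcoef v n * (RtoC 2 * freq v c n / laplace_denom a b (freq v c n))))%C.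
Proof.
  intros Hc H h E3 E4 E5 E6 Hh H3 H4 H5 H6.
  pose proof (Re_neq0 c ltac:(lra)) as Hc0.
  assert (Hh0 : h <> RtoC 0).
  { intros E. apply (Hh O). rewrite E. f_equal. simpl. ring. }
  assert (Hv0 : v <> RtoC 0).
  { intros E. apply Hh0. unfold h. rewrite E. field. apply RtoC_2_neq0. }
  pose proof (Re_freq v a b c n Hc H) as Hw.
  pose proof (Rle_abs (Re a)). pose proof (Rle_abs (- Re a)) as Ha. rewrite Rabs_Ropp in Ha.
  pose proof (Rle_abs (Re b)). pose proof (Rle_abs (- Re b)) as Hb. rewrite Rabs_Ropp in Hb.
  assert (F3 : (v * c - a - b + RtoC 2 * RtoC (INR n) * c = freq v c n - a - b)%C) by (unfold freq; ring).
  assert (F4 : (v * c - a + b + RtoC 2 * RtoC (INR n) * c = freq v c n - a + b)%C) by (unfold freq; ring).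
  assert (F5 : (v * c + a + b + RtoC 2 * RtoC (INR n) * c = freq v c n + a + b)%C) by (unfold freq; ring).
  assert (F6 : (v * c + a - b + RtoC 2 * RtoC (INR n) * c = freq v c n + a - b)%C) by (unfold freq; ring).
  assert (G3 : (freq v c n - a - b)%C <> RtoC 0) by (apply Re_neq0; cbn [Csub Cadd Copp Re]; lra).
  assert (G4 : (freq v c n - a + b)%C <> RtoC 0) by (apply Re_neq0; cbn [Csub Cadd Copp Re]; lra).
  assert (G5 : (freq v c n + a + b)%C <> RtoC 0) by (apply Re_neq0; cbn [Csub Cadd Copp Re]; lra).
  assert (G6 : (freq v c n + a - b)%C <> RtoC 0) by (apply Re_neq0; cbn [Csub Cadd Copp Re]; lra).
  pose proof (poch_ratio_half c _ s3 n Hc0 E3 H3 ltac:(rewrite F3; auto)) as R3.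
  pose proof (poch_ratio_half c _ s4 n Hc0 E4 H4 ltac:(rewrite F4; auto)) as R4.
  pose proof (poch_ratio_half c _ s5 n Hc0 E5 H5 ltac:(rewrite F5; auto)) as R5.
  pose proof (poch_ratio_half c _ s6 n Hc0 E6 H6 ltac:(rewrite F6; auto)) as R6.
  rewrite F3 in R3. rewrite F4 in R4. rewrite F5 in R5. rewrite F6 in R6.
  pose proof (poch_ratio_inv h n Hh) as Rh.
  pose proof (poch_neq0 _ n Hh). pose proof (poch_neq0 _ n H3). pose proof (poch_neq0 _ n H4).
  pose proof (poch_neq0 _ n H5). pose proof (poch_neq0 _ n H6).
  pose proof (RtoC_fact_neq0 n).
  unfold hyp_term. cbn [map Cprod fold_right].
  transitivity (bcoef v n * (poch (RtoC 1 + h) n * Cinv (poch h n)) *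
    (poch s3 n * Cinv (poch (RtoC 1 + s3) n)) * (poch s4 n * Cinv (poch (RtoC 1 + s4) n)) *
    (poch s5 n * Cinv (poch (RtoC 1 + s5) n)) * (poch s6 n * Cinv (poch (RtoC 1 + s6) n)))%C.
  - unfold bcoef. field. repeat split; auto.
  - rewrite R3, R4, R5, R6, Rh. unfold laplace_denom.
    assert (Ef : freq v c n = (RtoC 2 * (h + RtoC (INR n)) * c)%C).
    { unfold freq, h. field. apply RtoC_2_neq0. }
    rewrite Ef in *. replace v with (RtoC 2 * h)%C in * by (unfold h; field; apply RtoC_2_neq0).
    set (bc := bcoef _ n). clearbody bc. clearbody h.
    field. repeat split; auto using RtoC_2_neq0.
Qed.

Theorem mainTheorem13 (v a b c : Cx) :
  Re v < 4 ->
  0 < Re c ->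
  0 < Re (v * c + a + b)%C ->
  0 < Re (v * c + a - b)%C ->
  0 < Re (v * c - a + b)%C ->
  0 < Re (v * c - a - b)%C ->
  let h := (v / RtoC 2)%C in
  let s3 := (h - a / (RtoC 2 * c) - b / (RtoC 2 * c))%C in
  let s4 := (h - a / (RtoC 2 * c) + b / (RtoC 2 * c))%C in
  let s5 := (h + a / (RtoC 2 * c) + b / (RtoC 2 * c))%C in
  let s6 := (h + a / (RtoC 2 * c) - b / (RtoC 2 * c))%C in
  let P := ((v * c - a - b) * (v * c + a + b) * (v * c - a + b) * (v * c + a - b))%C in
  notZ0m h ->
  notZ0m (RtoC 1 + s3)%C -> notZ0m (RtoC 1 + s4)%C ->
  notZ0m (RtoC 1 + s5)%C -> notZ0m (RtoC 1 + s6)%C ->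
  exists S : Cx,
    hyp_series_cv [v; RtoC 1 + h; s3; s5; s4; s6]%C
                  [h; RtoC 1 + s3; RtoC 1 + s5; RtoC 1 + s4; RtoC 1 + s6]%C
                  (RtoC (-1)) S /\
    improper_integral_0_inf
      (fun x => (Csinh (a * RtoC x) * Csinh (b * RtoC x) / cosh_pow v c x)%C)
      (Cpow (RtoC 2) (v + RtoC 1) * v * a * b * c / P * S)%C.
Proof.
  intros Hv Hc P1 P2 P3 P4 h s3 s4 s5 s6 P Hh H3 H4 H5 H6.
  pose proof (Re_neq0 c ltac:(lra)) as Hc0.
  assert (Hv0 : v <> RtoC 0).
  { intros E. apply (Hh O). unfold h. rewrite E. apply Cx_eq; simpl; field. }
  assert (H : Rabs (Re a) + Rabs (Re b) < Re (v * c)%C).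
  { cbn [Csub Cadd Copp Re] in P1, P2, P3, P4.
    unfold Rabs; destruct (Rcase_abs (Re a)), (Rcase_abs (Re b)); lra. }
  assert (HP : P <> RtoC 0) by exact (laplace_denom_neq0 a b (v * c)%C H).
  destruct (integrand_integral v a b c Hv Hc H) as [L HL].
  set (k0 := (P / (RtoC 2 * v * c))%C).
  exists (k0 * L)%C. split.
  - assert (Hpart : forall N, Cpartial (hyp_term [v; RtoC 1 + h; s3; s5; s4; s6]%C
                  [h; RtoC 1 + s3; RtoC 1 + s5; RtoC 1 + s4; RtoC 1 + s6]%C (RtoC (-1))) N =
                  (k0 * laplace_sum v a b c (S N))%C).
    { intros N. rewrite Cpartial_Csum. unfold laplace_sum. rewrite <- Csum_scal.
      apply Csum_ext. intros n. apply hyp_term_laplace; auto;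
        unfold s3, s4, s5, s6, h; field; auto using RtoC_2_neq0. }
    split.
    + eapply Un_cv_ext; [|exact (CV_shift' _ 1 _ (proj1 (HL k0)))].
      intros N. cbv beta. rewrite Hpart. do 3 f_equal. lia.
    + replace (Im (k0 * L)%C) with (Re (mkC 0 (-1) * k0 * L)%C) by (simpl; ring).
      eapply Un_cv_ext; [|exact (CV_shift' _ 1 _ (proj1 (HL (mkC 0 (-1) * k0)%C)))].
      intros N. cbv beta. rewrite Hpart. replace (N + 1)%nat with (S N) by lia. simpl; ring.
  - set (k := (a * b * Cpow (RtoC 2) v)%C).
    replace (Cpow (RtoC 2) (v + RtoC 1) * v * a * b * c / P * (k0 * L))%C with (k * L)%C
      by (rewrite Cpow_2_add_1; unfold k, k0; field; repeat split; auto using RtoC_2_neq0).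
    set (f := fun x => _).
    assert (Ef : forall x, f x = (k * integrand v a b c x)%C) by (intros x; apply integrand_eq).
    assert (Hcont : forall x, 0 <= x ->
      continuous (fun t => Re (f t)) x /\ continuous (fun t => Im (f t)) x).
    { intros x Hx. destruct (integrand_continuous v a b c k x Hc Hx) as [C1 C2].
      split; [revert C1 | revert C2]; apply continuous_ext; intros t; rewrite Ef; reflexivity. }
    split.
    + intros B HB. split; constructor; apply ex_RInt_Reals_0;
        apply (ex_RInt_continuous (V := R_CompleteNormedModule)); intros x Hx;
        rewrite Rmin_left in Hx by lra;
        [exact (proj1 (Hcont x (proj1 Hx))) | exact (proj2 (Hcont x (proj1 Hx)))].
    + intros eps He.
      destruct (proj2 (HL k) eps He) as [M1 HM1].
      destruct (proj2 (HL (mkC 0 (-1) * k)%C) eps He) as [M2 HM2].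
      exists (Rmax 0 (Rmax M1 M2)). intros B HB pr1 pr2.
      pose proof (Rmax_l 0 (Rmax M1 M2)); pose proof (Rmax_r 0 (Rmax M1 M2)).
      pose proof (Rmax_l M1 M2); pose proof (Rmax_r M1 M2).
      specialize (HM1 B ltac:(lra) ltac:(lra)). specialize (HM2 B ltac:(lra) ltac:(lra)).
      rewrite <- !RInt_Reals. split.
      * rewrite (RInt_ext _ (fun x => Re (k * integrand v a b c x)%C)); [exact HM1|].
        intros x _. rewrite Ef. reflexivity.
      * rewrite (RInt_ext _ (fun x => Re (mkC 0 (-1) * k * integrand v a b c x)%C)).
        -- replace (Im (k * L)%C) with (Re (mkC 0 (-1) * k * L)%C) by (simpl; ring). exact HM2.
        -- intros x _. rewrite Ef. simpl. ring.
Qed.
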